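(* Fix an integer $k\ge1$. As $n\to\infty$, $$\mu_{2k}[N_n(a,b)]=\frac{(2k)!\,\beta_2^k}{k!\,2^k}\big(\mathbb E[N_n(a,b)]\big)^k+O\big((\mathbb E[N_n(a,b)])^{k-1}\big)$$ and $$\mu_{2k+1}[N_n(a,b)]=\frac{(2k+1)!\,\beta_2^{k-1}\beta_3}{(k-1)!\,2^{k-1}\,3!}\big(\mathbb E[N_n(a,b)]\big)^k+O\big((\mathbb E[N_n(a,b)])^{k-1}\big).$$
   Context: $P_n(x)=\sum_{j=0}^n\omega_j\sqrt{\binom nj}\,x^j$ with $\omega_j$ i.i.d. standard real Gaussian random variables. For $-\infty\le a<b\le\infty$ (where $a,b$ may depend on $n$), $N_n(a,b)$ is the number of real zeros of $P_n$ in $(a,b)$. $\mu_k[X]$ and $s_k[X]$ denote the $k$th central moment and $k$th cumulant of a random variable $X$. $\beta_k$ is the finite constant, independent of $n,a,b$, for which $s_k[N_n(a,b)]=\beta_k\mathbb E[N_n(a,b)]+O(1)$ as $n\to\infty$; since $\mathbb E[N_n(\mathbb R)]=\sqrt n$, equivalently $\beta_k=\lim_{n\to\infty}n^{-1/2}s_k[N_n(\mathbb R)]$.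
   Formalization: For k ≥ 3 it is additionally assumed that E[N_n(a,b)] stays bounded below by a positive constant for large n; otherwise the claim fails, e.g. on intervals (0,b_n) shrinking so fast that E[N_n] → 0. *)

(* Defs.v *)
From HB Require Import structures.
From mathcomp Require Import all_boot all_order all_algebra.
From mathcomp Require Import finmap.
From mathcomp Require Import all_classical all_reals all_analysis.

Set Implicit Arguments.
Unset Strict Implicit.
Unset Printing Implicit Defensive.

Import Order.TTheory GRing.Theory Num.Theory.
Import numFieldNormedType.Exports.

Local Open Scope classical_set_scope.
Local Open Scope ring_scope.

(* Mutual independence of a sequence of real random variables: the product rule
   for every finite subfamily. *)
Definition mutually_independent (R : realType) (d : measure_display)
    (T : measurableType d) (P : probability T R)
    (X : nat -> {RV P >-> R}) : Prop :=
  forall (s : seq nat) (A : nat -> set R), uniq s ->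
    (forall j, j \in s -> measurable (A j)) ->
    P (\bigcap_(j in [set` s]) (X j @^-1` A j)) =
    (\prod_(j <- s) P (X j @^-1` A j))%E.

Definition iid_std_gaussian (R : realType) (d : measure_display)
    (T : measurableType d) (P : probability T R)
    (omega : nat -> {RV P >-> R}) : Prop :=
  mutually_independent omega /\
  forall j (A : set R), measurable A ->
    distribution P (omega j) A = normal_prob 0 1 A.

Definition elliptic_poly (R : realType) (d : measure_display)
    (T : measurableType d) (P : probability T R) (omega : nat -> {RV P >-> R})
    (n : nat) (w : T) : {poly R} :=
  \poly_(j < n.+1) (omega j w * Num.sqrt ('C(n, j)%:R)).

(* [fset_set] sends infinite sets to the empty one, so the count is 0 (rather
   than infinite) when the polynomial vanishes identically, a null event.
   Zeros are counted without multiplicity; they are almost surely simple. *)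
Definition num_real_zeros (R : realType) (d : measure_display)
    (T : measurableType d) (P : probability T R) (omega : nat -> {RV P >-> R})
    (n : nat) (a b : \bar R) (w : T) : R :=
  (#|` fset_set [set x : R | (a < x%:E < b)%E /\
                             root (elliptic_poly omega n w) x] |)%:R.

Definition mean (R : realType) (d : measure_display) (T : measurableType d)
    (P : probability T R) (X : T -> R) : R :=
  fine ('E_P[X])%E.

Definition central_moment (R : realType) (d : measure_display)
    (T : measurableType d) (P : probability T R) (k : nat) (X : T -> R) : R :=
  mean P (fun w => (X w - mean P X) ^+ k).

(* The k-th Taylor coefficient at 0, times k!, of t |-> log E[exp (t X)]; here it
   is only applied to bounded X. *)
Definition cumulant (R : realType) (d : measure_display)
    (T : measurableType d) (P : probability T R) (k : nat) (X : T -> R) : R :=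
  derive1n k (fun t : R => ln (fine (mmt_gen_fun P X t))) 0.

(* [beta] is the constant with s_k[N_n(a,b)] = beta E[N_n(a,b)] + O(1) as n goes
   to infinity, for all intervals (a,b) = (a_n,b_n) possibly depending on n; it
   is chosen before the intervals, hence independent of n, a and b. *)
Definition cumulant_constant (R : realType) (d : measure_display)
    (T : measurableType d) (P : probability T R)
    (omega : nat -> {RV P >-> R}) (k : nat) (beta : R) : Prop :=
  forall a b : nat -> \bar R, (forall n, (a n < b n)%E) ->
    (fun n => cumulant P k (num_real_zeros omega n (a n) (b n)) -
              beta * mean P (num_real_zeros omega n (a n) (b n)))
    =O_\oo (fun _ : nat => 1 : R).

(* Main.v *)
(* The moment-cumulant recursion
     mu_{j+1} = sum_{1 <= i <= j} C(j,i) s_{i+1} mu_{j-i}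
   for central moments turns s_j = beta_j E + O(1) into the two expansions as long
   as E stays bounded below: at top order only s_2 and, for odd moments, one factor
   s_3 contribute.  When E is small (allowed for k <= 2) the case k = 2 also needs
   E[N^5] = O(E[N]).  This comes from rotation invariance: in the angle
   theta = arctan x the random polynomial becomes a Gaussian trigonometric form
   whose law is invariant under rotations, so about 1/E disjoint rotated copies of
   the arc of (a,b) tile an arc J with E[N(J)] <= 1.  The cumulants, hence all
   moments, of N(J) are O(1), and superadditivity of the fifth power gives
   E[N^5] <= O(E) E[N(J)^5] = O(E). *)

Require Import Defs.
From HB Require Import structures.
From mathcomp Require Import all_boot all_order all_algebra.
From mathcomp Require Import finmap.
From mathcomp Require Import ring lra zify.
From mathcomp Require Import all_classical all_reals all_analysis.
From mathcomp Require Import measurable_realfun.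
Import Order.TTheory GRing.Theory Num.Theory.
Import numFieldNormedType.Exports.
Local Open Scope classical_set_scope.
Local Open Scope ring_scope.

Set Implicit Arguments.
Unset Strict Implicit.
Unset Printing Implicit Defensive.

(** * Moments and cumulants of a finite distribution *)

Section Smooth.
Context {R : realType}.
Implicit Types f g : R -> R.

(** The hypothesis on cumulants is uniform over all sequences of intervals, and short arcs are
    controlled through this uniformity: J is chosen separately for each n, starting at the angle
    -pi/2, so that it comes from an interval with left end -oo, and the resulting sequence is fed
    back into the hypothesis. For small E a count behaves like an indicator: its central moments are
    in general of order E and no smaller. This meets the error E^(k-1) for k = 2 but not beyond, and
    E[N^5] is what the central moments of orders 4 and 5 require. As N takes values in {0, ..., n},
    every expectation is a finite sum and the cumulant generating function is the logarithm of a
    finite exponential sum, hence smooth. Rotation invariance has two sources. Plane rotations act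
    on the weighted monomials by orthogonal matrices, because the binomial weights turn the scalar
    product of two such vectors into the n-th power of the scalar product of two points of the
    plane. A standard Gaussian vector keeps its law under every orthogonal matrix, which is reduced
    to rotations of two coordinates and, for these, to three shears preserving Lebesgue measure. *)

Fixpoint diffn (k : nat) (f : R -> R) : Prop :=
  if k is k'.+1 then (forall x, derivable f x 1) /\ diffn k' (derive1 f)
  else True.

Lemma diffnW k f : diffn k.+1 f -> diffn k f.
Proof. by elim: k f => // k IH f [df] /IH. Qed.

Lemma derive1_add f g : (forall x, derivable f x 1) -> (forall x, derivable g x 1) ->
  derive1 (fun x => f x + g x) = (fun x => derive1 f x + derive1 g x).
Proof.
move=> df dg; apply/funext => x; rewrite !derive1E.
exact: (deriveD (df x) (dg x)).
Qed.

Lemma derive1_mul f g : (forall x, derivable f x 1) -> (forall x, derivable g x 1) ->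
  derive1 (fun x => f x * g x) = (fun x => derive1 f x * g x + f x * derive1 g x).
Proof.
move=> df dg; apply/funext => x; rewrite !derive1E.
rewrite (deriveM (df x) (dg x)) /GRing.scale/=; ring.
Qed.

Lemma diffnD k f g : diffn k f -> diffn k g -> diffn k (fun x => f x + g x).
Proof.
elim: k f g => //= k IH f g [df kf] [dg kg]; split.
  by move=> x; exact: derivableD.
by rewrite derive1_add//; exact: IH.
Qed.

Lemma diffnM k f g : diffn k f -> diffn k g -> diffn k (fun x => f x * g x).
Proof.
elim: k f g => // k IH f g Hf Hg.
have [df kf] := Hf; have [dg kg] := Hg; split.
  by move=> x; exact: derivableM.
by rewrite derive1_mul//; apply: diffnD; apply: IH => //; exact: diffnW.
Qed.

Lemma diffn_cst k (c : R) : diffn k (fun=> c).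
Proof.
elim: k c => //= k IH c; split => //.
rewrite (_ : derive1 _ = fun=> 0) //.
by apply/funext => x; rewrite derive1_cst.
Qed.

Lemma diffnV k f : (forall x, f x != 0) -> diffn k f -> diffn k (fun x => (f x)^-1).
Proof.
move=> f0; elim: k => // k IH Hf; have [df kf] := Hf; split.
  by move=> x; apply: derivableV.
rewrite (_ : derive1 _ = fun x => -1 * (derive1 f x * ((f x)^-1 * (f x)^-1))); last first.
  apply/funext => x; rewrite !derive1E deriveV// /GRing.scale/= expr2 invfM; ring.
apply: diffnM; first exact: diffn_cst.
have := IH (diffnW Hf) => Hi.
by apply: diffnM => //; apply: diffnM.
Qed.

(** Differentiability is asked on the whole line, so that the derivative rules are equalities of
    functions and can be iterated. *)
Definition smooth f := forall k, diffn k f.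

Lemma smoothD f g : smooth f -> smooth g -> smooth (fun x => f x + g x).
Proof. by move=> sf sg k; exact: diffnD. Qed.

Lemma smoothM f g : smooth f -> smooth g -> smooth (fun x => f x * g x).
Proof. by move=> sf sg k; exact: diffnM. Qed.

Lemma smooth_derivable f : smooth f -> forall x, derivable f x 1.
Proof. by move=> /(_ 1%N)[]. Qed.

Lemma smooth_derive f : smooth f -> smooth (derive1 f).
Proof. by move=> sf k; have [] := sf k.+1. Qed.

Lemma derive1nSr k f : derive1n k.+1 f = derive1n k (derive1 f).
Proof. by rewrite /derive1n iterSr. Qed.

Lemma derive1n_cst k (c : R) : derive1n k.+1 (fun=> c) = fun=> 0.
Proof.
have E (e : R) : derive1 (fun=> e) = (fun=> 0 : R).
  by apply/funext => x; rewrite derive1_cst.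
by elim: k c => [|k IH] c; rewrite derive1nSr E.
Qed.

Lemma derive1nD k f g : smooth f -> smooth g ->
  derive1n k (fun x => f x + g x) = (fun x => derive1n k f x + derive1n k g x).
Proof.
elim: k f g => // k IH f g sf sg; rewrite !derive1nSr derive1_add.
- by rewrite IH//; exact: smooth_derive.
- exact: smooth_derivable.
- exact: smooth_derivable.
Qed.

Lemma sum_ord_recl (F : nat -> R) n : \sum_(i < n.+1) F i = F 0%N + \sum_(i < n) F i.+1.
Proof. by rewrite big_ord_recl. Qed.

Lemma Leibniz k f g x : smooth f -> smooth g ->
  derive1n k (fun x => f x * g x) x =
  \sum_(i < k.+1) 'C(k, i)%:R * derive1n i f x * derive1n (k - i) g x.
Proof.
elim: k f g => [|k IH] f g sf sg.
  by rewrite big_ord_recl big_ord0 /= bin0 mul1r addr0.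
have sf' := smooth_derive sf; have sg' := smooth_derive sg.
rewrite derive1nSr derive1_mul; try exact: smooth_derivable.
rewrite derive1nD; try exact: smoothM.
rewrite !IH//.
rewrite (sum_ord_recl (fun i => 'C(k.+1, i)%:R * derive1n i f x * derive1n (k.+1 - i) g x)).
rewrite bin0 subn0 mul1r.
under [in RHS]eq_bigr => i _ do
  rewrite binS natrD subSS mulrDl mulrDl (derive1nSr i).
rewrite big_split /= addrA addrC; congr (_ + _).
rewrite (sum_ord_recl (fun i => 'C(k, i)%:R * derive1n i f x * derive1n (k - i) (derive1 g) x)).
rewrite bin0 subn0 mul1r -derive1nSr; congr (_ + _).
rewrite [RHS]big_ord_recr /= bin_small// !mul0r addr0.
apply: eq_bigr => i _; rewrite -derive1nSr -derive1nSr.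
by rewrite -subSn.
Qed.

Lemma derive1_ln_comp (M : R -> R) : (forall x, 0 < M x) ->
  (forall x, derivable M x 1) ->
  derive1 (fun x => ln (M x)) = (fun x => derive1 M x * (M x)^-1) /\
  forall x, derivable (fun x => ln (M x)) x 1.
Proof.
move=> M0 dM.
have H x : is_derive x (1 : R) (fun x => ln (M x)) ((derive1 M) x * (M x)^-1).
  have h1 : is_derive (M x) (1 : R) (@ln R) (M x)^-1 by exact: is_derive1_ln.
  have h2 : is_derive x (1 : R) M ((derive1 M) x).
    by rewrite derive1E; exact: derivableP.
  have := is_derive1_comp h1 h2.
  by rewrite /comp /GRing.scale /= mulrC.
split; first by apply/funext => x; rewrite derive1E; have := H x; case.
by move=> x; have := H x; case.
Qed.

Lemma smooth_ln_comp (M : R -> R) : (forall x, 0 < M x) -> smooth M ->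
  smooth (fun x => ln (M x)).
Proof.
move=> M0 sM [//|k].
have [E d] := derive1_ln_comp M0 (smooth_derivable sM); split => //.
rewrite E; apply: diffnM; first exact: smooth_derive.
by apply: diffnV => // x; rewrite gt_eqF.
Qed.

(** The family is closed under differentiation, which multiplies the weights by the exponents. Two
    instances matter: the moment generating function of a law on integers, and that of the variable
    centred at a. *)
Definition expsum m (p e : 'I_m -> R) (t : R) := \sum_(i < m) p i * expR (t * e i).

Lemma is_derive_expsum m (p e : 'I_m -> R) (t : R) :
  is_derive t (1 : R) (expsum p e) (expsum (fun i => p i * e i) e t).
Proof.
have -> : expsum p e = \sum_(i < m) (fun t => p i * expR (t * e i)).
  by apply/funext => u; rewrite /expsum fct_sumE.
rewrite /expsum; apply: is_derive_sum => i.
have h1 : is_derive (t * e i) (1 : R) (@expR R) (expR (t * e i)) by exact: is_derive_expR.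
have h2 : is_derive t (1 : R) (fun t => t * e i) (e i).
  by apply: is_derive_eq; rewrite /GRing.scale/=; ring.
have h3 := @is_derive1_comp R expR (fun t => t * e i) t _ _ h1 h2.
have h4 := @is_deriveZ _ _ _ _ (p i) _ _ _ h3.
by apply: (is_derive_eq h4); rewrite /GRing.scale/=; ring.
Qed.

Lemma derive_expsum m (p e : 'I_m -> R) :
  derive1 (expsum p e) = expsum (fun i => p i * e i) e.
Proof. by apply/funext => t; rewrite derive1E; have := is_derive_expsum p e t; case. Qed.

Lemma smooth_expsum m (p e : 'I_m -> R) : smooth (expsum p e).
Proof.
move=> k; elim: k p => // k IH p; split; last by rewrite derive_expsum.
by move=> t; have := is_derive_expsum p e t; case.
Qed.

Lemma derive1n_expsum m (p e : 'I_m -> R) k :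
  derive1n k (expsum p e) = expsum (fun i => p i * e i ^+ k) e.
Proof.
elim: k p => [|k IH] p.
  by apply/funext => t; apply: eq_bigr => i _; rewrite expr0 mulr1.
rewrite derive1nSr derive_expsum IH; congr (expsum _ _).
by apply/funext => i; rewrite exprS mulrA.
Qed.

Definition moment_about m (p : 'I_m -> R) (a : R) (k : nat) :=
  \sum_(i < m) p i * (i%:R - a) ^+ k.

(** With M the moment generating function and K = ln M, the moments about a are the derivatives at 0
    of G(t) = exp(-a t) M(t), and G' = (K' - a) G. The Leibniz rule applied to the j-th derivative
    of this product gives the recursion; the constant a only meets the first cumulant, hence the
    correction at i = 0. *)
Lemma moment_cumulant_rec m (p : 'I_m -> R) (a : R) (s : nat -> R) (j : nat) :
  (forall i, 0 <= p i) -> \sum_i p i = 1 ->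
  (forall i, s i = derive1n i (fun t => ln (\sum_(l < m) p l * expR (t * l%:R))) 0) ->
  moment_about p a j.+1 =
  \sum_(i < j.+1) 'C(j, i)%:R * (s i.+1 - a *+ (i == 0%N :> nat)) * moment_about p a (j - i).
Proof.
move=> p0 p1 sE.
pose M := expsum p (fun l => l%:R).
have M0 t : 0 < M t.
  have : 0 < \sum_i p i by rewrite p1.
  rewrite lt_def sumr_ge0// andbT psumr_neq0// => /hasP[i _ /andP[_ pi]].
  apply: (@lt_le_trans _ _ (p i * expR (t * i%:R))); first by rewrite mulr_gt0// expR_gt0.
  rewrite /M /expsum (bigD1 i)//= lerDl sumr_ge0// => l _.
  by rewrite mulr_ge0// expR_ge0.
have sM : smooth M := smooth_expsum _ _.
pose K t := ln (M t).
have sK : smooth K := smooth_ln_comp M0 sM.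
pose G := expsum p (fun l => l%:R - a).
have momE k : moment_about p a k = derive1n k G 0.
  rewrite derive1n_expsum /expsum; apply: eq_bigr => i _.
  by rewrite mul0r expR0 mulr1.
pose H := (fun t => (derive1 K) t + - a).
have sH : smooth H by apply: smoothD; [exact: smooth_derive|move=> ?; exact: diffn_cst].
have GE : (derive1 G) = fun t => H t * G t.
  have [K' _] := derive1_ln_comp M0 (smooth_derivable sM).
  apply/funext => t; rewrite /H K' (derive_expsum p) [LHS]/expsum.
  have expE i : expR (t * (i%:R - a)) = expR (t * i%:R) * expR (- (t * a)).
    by rewrite -expRD mulrBr.
  have -> : G t = M t * expR (- (t * a)).
    by rewrite /G /M /expsum mulr_suml; apply: eq_bigr => i _; rewrite expE mulrA.
  have alg (u v w : R) : v != 0 -> (u / v - a) * (v * w) = u * w - v * (a * w).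
    by move=> v0; field.
  rewrite alg ?gt_eqF//.
  rewrite derive_expsum /M /expsum !mulr_suml -sumrB.
  by apply: eq_bigr => i _; rewrite expE; ring.
rewrite momE derive1nSr GE Leibniz//; last exact: smooth_expsum.
apply: eq_bigr => i _; rewrite momE; congr (_ * _ * _).
rewrite sE -/K.
rewrite derive1nSr /H derive1nD; [|exact: smooth_derive|move=> ?; exact: diffn_cst].
congr (_ + _).
case: (nat_of_ord i) => [|l]; first by rewrite mulr1n.
by rewrite derive1n_cst mulr0n oppr0.
Qed.

End Smooth.

(** * Asymptotics of central moments *)

Section Domination.
Context {R : realType} (D : nat -> Prop).
Implicit Types f g : nat -> R.

(** Big-O along the indices satisfying [D], so that the n with a small mean can be treated apart.
    The gauge carries no absolute value, being nonnegative wherever it is used. *)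
Definition domin f g := exists C : R, exists N, forall n,
  (N <= n)%N -> D n -> `|f n| <= C * g n.

Lemma domin_ext f f' g : (forall n, D n -> f n = f' n) -> domin f g -> domin f' g.
Proof. by move=> e [C [N H]]; exists C, N => n Nn Dn; rewrite -e//; exact: H. Qed.

Lemma domin0 g : domin (fun=> 0) g.
Proof. by exists 0, 0%N => n _ _; rewrite normr0 mul0r. Qed.

Lemma dominxx g : (forall n, D n -> 0 <= g n) -> domin g g.
Proof. by move=> g0; exists 1, 0%N => n _ Dn; rewrite mul1r ger0_norm// g0. Qed.

Lemma dominD f1 f2 g : domin f1 g -> domin f2 g -> domin (fun n => f1 n + f2 n) g.
Proof.
move=> [C1 [N1 H1]] [C2 [N2 H2]]; exists (C1 + C2), (maxn N1 N2) => n.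
rewrite geq_max => /andP[n1 n2] Dn; rewrite mulrDl.
by apply: (le_trans (ler_normD _ _)); apply: lerD; [exact: H1|exact: H2].
Qed.

Lemma dominM f1 f2 g1 g2 : domin f1 g1 -> domin f2 g2 ->
  domin (fun n => f1 n * f2 n) (fun n => g1 n * g2 n).
Proof.
move=> [C1 [N1 H1]] [C2 [N2 H2]]; exists (C1 * C2), (maxn N1 N2) => n.
rewrite geq_max => /andP[n1 n2] Dn; rewrite normrM mulrACA.
by apply: ler_pM => //; [exact: H1|exact: H2].
Qed.

Lemma dominZ (c : R) f g : domin f g -> domin (fun n => c * f n) g.
Proof.
move=> [C [N H]]; exists (`|c| * C), N => n Nn Dn.
by rewrite normrM -mulrA ler_wpM2l// H.
Qed.

Lemma domin_sum m (F : 'I_m -> nat -> R) g : (forall i, domin (F i) g) ->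
  domin (fun n => \sum_i F i n) g.
Proof.
move=> H; elim: m F H => [|m IH] F H.
  by apply: domin_ext (domin0 g) => n _; rewrite big_ord0.
apply: domin_ext (dominD (H ord0) (IH _ (fun i => H (lift ord0 i)))) => n _.
by rewrite big_ord_recl.
Qed.

Variables (E : nat -> R) (c : R).
Hypothesis c0 : 0 < c.
Hypothesis cE : forall n, D n -> c <= E n.

Let E0 n : D n -> 0 < E n. Proof. by move=> /cE; apply: lt_le_trans. Qed.

Lemma domin_divE f k : domin (fun n => E n * f n) (fun n => E n ^+ k.+1) ->
  domin f (fun n => E n ^+ k).
Proof.
move=> [C [N H]]; exists C, N => n Nn Dn; have := H n Nn Dn.
by rewrite normrM gtr0_norm ?E0// exprS mulrCA ler_pM2l// E0.
Qed.

Lemma domin_pow f (i j : nat) : (i <= j)%N -> domin f (fun n => E n ^+ i) ->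
  domin f (fun n => E n ^+ j).
Proof.
move=> /subnK <-; elim: (j - i)%N => // l IH /IH [C [N H]].
exists (C / c), N => n Nn Dn; apply: (le_trans (H n Nn Dn)).
rewrite addSn exprS.
have CE : 0 <= C * E n ^+ (l + i) by apply: le_trans (H n Nn Dn).
rewrite (_ : C / c * _ = (C * E n ^+ (l + i)) * (E n / c)); last by field; rewrite gt_eqF.
by rewrite ler_peMr// ler_pdivlMr// mul1r cE.
Qed.

Lemma domin_mulE f k : domin f (fun n => E n ^+ k) ->
  domin (fun n => E n * f n) (fun n => E n ^+ k.+1).
Proof.
move=> Hf; apply: domin_ext (_ : domin (fun n => E n * f n) _); first by [].
have := dominM (dominxx (fun n Dn => ltW (E0 Dn))) Hf.
by under [X in _ -> domin _ X]funext do rewrite exprS.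
Qed.

Lemma domin_mulEV f k : domin (fun n => E n * f n) (fun n => E n ^+ k) ->
  domin f (fun n => E n ^+ k).
Proof. by move=> Hf; apply: domin_divE; exact: domin_pow Hf. Qed.

Variables (s : nat -> nat -> R) (mu : nat -> nat -> R) (beta : nat -> R).
Hypothesis mu0 : forall n, mu 0 n = 1.
Hypothesis mu1 : forall n, mu 1 n = 0.
Hypothesis murec : forall j n, D n -> mu j.+2 n =
  \sum_(i < j.+1) 'C(j.+1, i.+1)%:R * s i.+2 n * mu (j - i)%N n.
Hypothesis sE : forall j, (1 <= j)%N -> domin (fun n => s j n - beta j * E n) (fun=> 1).

Let sO j : (1 <= j)%N -> domin (s j) (fun n => E n ^+ 1).
Proof.
move=> j1; have h1 : domin (fun n => s j n - beta j * E n) (fun n => E n ^+ 1).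
  by apply: (@domin_pow _ 0 1) => //; under [X in domin _ X]funext do rewrite expr0; exact: sE.
have h2 : domin (fun n => beta j * E n) (fun n => E n ^+ 1).
  apply: dominZ; under [X in domin _ X]funext do rewrite expr1.
  by apply: dominxx => n Dn; exact: ltW (E0 Dn).
by apply: domin_ext (dominD h1 h2) => n _; rewrite subrK.
Qed.

(** The double factorial (2k-1)!!, the 2k-th moment of the standard normal law. *)
Definition even_coef (k : nat) : R := (2 * k)`!%:R / (k`!%:R * 2 ^+ k).
(** Writing k / k! instead of 1 / (k-1)! makes the coefficient vanish at k = 0, in agreement with
    the vanishing first central moment from which the induction starts. *)
Definition odd_coef (k : nat) : R :=
  k%:R * (2 * k + 1)`!%:R / (k`!%:R * 2 ^+ (k - 1) * 3`!%:R).

Lemma even_coefS k : even_coef k.+1 = (2 * k + 1)%:R * even_coef k.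
Proof.
have h1 : (k`!)%:R != 0 :> R by rewrite pnatr_eq0 -lt0n fact_gt0.
have h2 : (2 : R) ^+ k != 0 by rewrite expf_neq0// pnatr_eq0.
have h3 : k%:R + 1 != 0 :> R by rewrite natr1 pnatr_eq0.
rewrite /even_coef (_ : 2 * k.+1 = (2 * k).+2)%N; last lia.
rewrite !factS !natrM exprS.
have n2 : (2 * k).+2%:R = 2 * k%:R + 2 :> R by rewrite -natrM -natrD addn2.
have n1 : (2 * k).+1%:R = 2 * k%:R + 1 :> R by rewrite -natrM natr1.
rewrite addn1 n2 n1 -(natr1 k).
by field; rewrite h1 h2 h3.
Qed.

Lemma odd_coefS k : odd_coef k.+1 = (2 * k + 3)`!%:R / (k`!%:R * 2 ^+ k * 6).
Proof.
rewrite /odd_coef subSS subn0 (_ : 2 * k.+1 + 1 = 2 * k + 3)%N; last lia.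
have h1 : (k`!)%:R != 0 :> R by rewrite pnatr_eq0 -lt0n fact_gt0.
have h2 : (2 : R) ^+ k != 0 by rewrite expf_neq0// pnatr_eq0.
have h3 : k%:R + 1 != 0 :> R by rewrite natr1 pnatr_eq0.
rewrite (factS k) natrM -natr1 (_ : 3`! = 6)%N//.
by field; rewrite h1 h2 h3.
Qed.

(** Top-order balance of the recursion for the central moment of order 2k+3: s_2 meets the odd main
    term of index k with weight C(2k+2,1), and s_3 meets the even one with weight C(2k+2,2). *)
Lemma odd_coef_rec k (b2 b3 : R) :
  odd_coef k.+1 * b2 ^+ k * b3 =
  (2 * k + 2)%:R * (b2 * (odd_coef k * b2 ^+ (k - 1) * b3)) +
  'C(2 * k + 2, 2)%:R * (b3 * (even_coef k * b2 ^+ k)).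
Proof.
have binE : 'C(2 * k + 2, 2)%:R = (2 * k%:R + 2) * (2 * k%:R + 1) / 2 :> R.
  have h : ('C(2 * k + 2, 2) * 2 = (2 * k + 2) * (2 * k + 1))%N.
    by have := bin_ffact (2 * k + 2) 2; rewrite ffactnS ffactn1 => ->; congr muln; lia.
  have := congr1 (fun n => n%:R : R) h; rewrite /= !(natrM, natrD) => h'.
  by apply: (mulIf (_ : (2 : R) != 0)); rewrite ?pnatr_eq0// h'; field.
(* At k = 0 the exponent k - 1 is truncated to 0, harmlessly, since [odd_coef 0] vanishes. *)
case: k => [|k] in binE *.
  rewrite odd_coefS binE /odd_coef /even_coef !mul0r !mulr0 !expr0.
  rewrite (_ : (2 * 0 + 3)`! = 6)%N// muln0 !fact0.
  by field.
rewrite binE even_coefS !odd_coefS /even_coef subSS subn0.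
have h1 : (k`!)%:R != 0 :> R by rewrite pnatr_eq0 -lt0n fact_gt0.
have h2 : (2 : R) ^+ k != 0 by rewrite expf_neq0// pnatr_eq0.
have h3 : k%:R + 1 != 0 :> R by rewrite natr1 pnatr_eq0.
have n5 : (2 * k).+4.+1%:R = 2 * k%:R + 5 :> R by rewrite -natrM -natrD addnS addn4.
have n4 : (2 * k).+4%:R = 2 * k%:R + 4 :> R by rewrite -natrM -natrD addn4.
have n3 : (2 * k).+3%:R = 2 * k%:R + 3 :> R by rewrite -natrM -natrD addn3.
have n2 : (2 * k).+2%:R = 2 * k%:R + 2 :> R by rewrite -natrM -natrD addn2.
have n1 : (2 * k).+1%:R = 2 * k%:R + 1 :> R by rewrite -natrM natr1.
have -> : (2 * k.+1 + 3 = (2 * k).+4.+1)%N by lia.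
have -> : (2 * k.+1 + 2 = (2 * k).+4)%N by lia.
rewrite addn3 addn1 !factS !natrM !exprS n5 n4 n3 n2 n1 -(natr1 k).
by field; rewrite h1 h2 h3.
Qed.

Let even_main k n := even_coef k * beta 2 ^+ k * E n ^+ k.
Let odd_main k n := odd_coef k * beta 2 ^+ (k - 1) * beta 3 * E n ^+ k.

(** The errors are multiplied by E and compared with E^k: the intended gauge E^(k-1) would be
    truncated at k = 0, where the induction starts. *)
Let asymp k :=
  domin (fun n => E n * (mu (2 * k)%N n - even_main k n)) (fun n => E n ^+ k) /\
  domin (fun n => E n * (mu (2 * k + 1)%N n - odd_main k n)) (fun n => E n ^+ k).

Let dominEk (e : R) k : domin (fun n => e * E n ^+ k) (fun n => E n ^+ k).
Proof. by apply/dominZ/dominxx => n Dn; rewrite exprn_ge0// ltW// E0. Qed.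

Let dominsE j k f : (1 <= j)%N -> domin f (fun n => E n ^+ k) ->
  domin (fun n => (s j n - beta j * E n) * f n) (fun n => E n ^+ k).
Proof.
move=> j1 Hf; have := dominM (sE j1) Hf.
by under [X in domin _ X -> _]funext do rewrite mul1r.
Qed.

Let dominME i j f g : domin f (fun n => E n ^+ i) -> domin g (fun n => E n ^+ j) ->
  domin (fun n => f n * g n) (fun n => E n ^+ (i + j)).
Proof.
move=> Hf Hg; have := dominM Hf Hg.
by under [X in domin _ X -> _]funext do rewrite -exprD.
Qed.

Let asymp_growth k j : asymp k -> (j./2 = k)%N -> domin (mu j) (fun n => E n ^+ k).
Proof.
move=> [Ae Ao] jk.
have [oj|ej] := boolP (odd j).
  have -> : j = (2 * k + 1)%N by rewrite -[LHS]odd_double_half oj jk addnC mul2n.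
  apply: domin_ext (dominD (domin_mulEV Ao) (dominEk (odd_coef k * beta 2 ^+ (k - 1) * beta 3) k)) => n _.
  by rewrite subrK.
have -> : j = (2 * k)%N by rewrite -[LHS]odd_double_half (negbTE ej) jk add0n mul2n.
apply: domin_ext (dominD (domin_mulEV Ae) (dominEk (even_coef k * beta 2 ^+ k) k)) => n _.
by rewrite subrK.
Qed.

(* In the recursion only the terms with the cumulants of order two and (for odd
   index) three reach the top order, each higher cumulant costing a power of E. *)
Lemma asymp_all k : asymp k.
Proof.
elim/ltn_ind: k => -[|k] IH.
  rewrite /asymp /even_main /odd_main /even_coef /odd_coef; split.
    apply: domin_ext (domin0 _) => n _.
    by rewrite muln0 mu0 fact0 !expr0; field.
  apply: domin_ext (domin0 _) => n _.
  by rewrite muln0 add0n mu1 !mul0r subrr mulr0.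
have G j : (j <= 2 * k + 1)%N -> domin (mu j) (fun n => E n ^+ j./2).
  move=> jk; apply: (asymp_growth (IH j./2 _)) => //; lia.
have [Ae Ao] := IH k (ltnSn k).
have Ge : domin (mu (2 * k)%N) (fun n => E n ^+ k).
  by have := G (2 * k)%N; rewrite (_ : (2 * k)./2 = k); [apply; lia|lia].
have Go : domin (mu (2 * k + 1)%N) (fun n => E n ^+ k).
  by have := G (2 * k + 1)%N; rewrite (_ : (2 * k + 1)./2 = k); [apply; lia|lia].
(* The cumulant is O(E) and the moment O(E^floor((j-i)/2)), so the product is O(E^k) once
   floor((j-i)/2) < k. Only s_2 and, in the odd case, s_3 escape this bound. *)
have rest j (i : nat) : (1 <= i)%N -> (i <= j)%N -> (j - i <= 2 * k + 1)%N ->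
    ((j - i)./2 < k)%N ->
    domin (fun n => 'C(j.+1, i.+1)%:R * s i.+2 n * mu (j - i)%N n) (fun n => E n ^+ k).
  move=> i1 ij jik jik2.
  apply: domin_ext (dominZ ('C(j.+1, i.+1)%:R) (domin_pow (_ : 1 + (j - i)./2 <= k)%N
    (dominME (sO (_ : 1 <= i.+2)%N) (G _ jik)))) => //.
  by move=> n _; rewrite mulrA.
split.
  apply: domin_mulE.
  rewrite (_ : (2 * k.+1)%N = (2 * k).+2)%N; last lia.
  have H1 := dominZ (2 * k + 1)%:R (dominsE (_ : 1 <= 2)%N Ge).
  have H2 := dominZ (2 * k + 1)%:R (dominZ (beta 2) Ae).
  have H3 : domin (fun n => \sum_(i < 2 * k) 'C((2 * k).+1, i.+2)%:R * s i.+3 n * mu (2 * k - i.+1)%N n)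
       (fun n => E n ^+ k).
    by apply: domin_sum => i; have := ltn_ord i => ik; apply: (rest _ i.+1) => //; lia.
  apply: domin_ext (dominD (dominD (H1 erefl) H2) H3) => n Dn.
  rewrite murec// big_ord_recl bin1 subn0 /even_main even_coefS addn1 !exprS.
  rewrite (_ : \sum_(i < 2 * k) _ = \sum_(i < 2 * k) 'C((2 * k).+1, i.+2)%:R * s i.+3 n * mu (2 * k - i.+1)%N n)//.
  ring.
apply: domin_mulE.
rewrite (_ : (2 * k.+1 + 1)%N = (2 * k + 1).+2)%N; last lia.
have H1 := dominZ (2 * k).+2%:R (dominsE (_ : 1 <= 2)%N Go).
have H2 := dominZ (2 * k).+2%:R (dominZ (beta 2) Ao).
have H3 := dominZ ('C((2 * k).+2, 2)%:R) (dominsE (_ : 1 <= 3)%N Ge).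
have H4 := dominZ ('C((2 * k).+2, 2)%:R) (dominZ (beta 3) Ae).
have H5 : domin (fun n => \sum_(i < 2 * k) 'C((2 * k + 1).+1, i.+3)%:R * s i.+4 n * mu (2 * k + 1 - i.+2)%N n)
     (fun n => E n ^+ k).
  by apply: domin_sum => i; have := ltn_ord i => ik; apply: (rest _ i.+2) => //; lia.
apply: domin_ext (dominD (dominD (dominD (H1 erefl) H2) (dominD (H3 erefl) H4)) H5) => n Dn.
rewrite murec// addn1 big_ord_recl bin1 subn0 big_ord_recl.
rewrite /odd_main subSS subn0 odd_coef_rec addn2.
rewrite /even_main exprS.
rewrite (_ : \sum_(i < 2 * k) _ = \sum_(i < 2 * k) 'C((2 * k).+2, i.+3)%:R * s i.+4 n * mu ((2 * k).+1 - i.+2)%N n)//.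
rewrite (_ : ((2 * k).+1 - lift ord0 ord0)%N = 2 * k)%N; last by rewrite lift0 subSS subn0.
rewrite lift0 /=.
ring.
Qed.

Lemma asymp_even k : (1 <= k)%N ->
  domin (fun n => mu (2 * k)%N n - even_coef k * beta 2 ^+ k * E n ^+ k) (fun n => E n ^+ (k - 1)).
Proof.
by case: k => // k _; have [H _] := asymp_all k.+1; apply: domin_divE; rewrite subSS subn0; exact: H.
Qed.

Lemma asymp_odd k : (1 <= k)%N ->
  domin (fun n => mu (2 * k + 1)%N n - odd_coef k * beta 2 ^+ (k - 1) * beta 3 * E n ^+ k)
    (fun n => E n ^+ (k - 1)).
Proof.
by case: k => // k _; have [_ H] := asymp_all k.+1; apply: domin_divE; rewrite subSS subn0; move: H; rewrite /odd_main subSS subn0.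
Qed.

End Domination.

(** Moments are polynomials in the cumulants, so bounded cumulants give bounded moments. *)
Lemma domin_raw_moments {R : realType} (D : nat -> Prop) (s m : nat -> nat -> R) :
  (forall n, m 0 n = 1) ->
  (forall j n, D n -> m j.+1 n = \sum_(i < j.+1) 'C(j, i)%:R * s i.+1 n * m (j - i)%N n) ->
  (forall j, (1 <= j)%N -> domin D (s j) (fun=> 1)) ->
  forall j, domin D (m j) (fun=> 1).
Proof.
move=> m0 mrec sO; elim/ltn_ind => -[|j] IH.
  by apply: domin_ext (dominxx (fun _ _ => ler01)) => n _; rewrite m0.
have H : domin D (fun n => \sum_(i < j.+1) 'C(j, i)%:R * s i.+1 n * m (j - i)%N n) (fun=> 1).
  apply: domin_sum => i.
  apply: domin_ext (dominZ 'C(j, i)%:R (_ : domin D (fun n => s i.+1 n * m (j - i)%N n) _)).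
    by move=> n _; rewrite mulrA.
  have := dominM (sO i.+1 isT) (IH (j - i)%N _).
  by under [X in (_ -> domin _ _ X) -> _]funext do rewrite mul1r; apply; lia.
by apply: domin_ext H => n Dn; rewrite mrec.
Qed.

(** * Counting zeros *)

Section ZeroCount.
Context {R : realType}.
Implicit Types (g : R -> R) (a b : R).

Definition zeros_in g a b : set R := [set x | a < x < b /\ g x = 0].

Definition zero_count g a b : nat := #|` fset_set (zeros_in g a b) |.

(** Zeros are picked in increasing order. Unlike the cardinal, this remains meaningful for
    infinitely many zeros, and its recursive form lends itself to countable unions of measurable
    events. *)
Fixpoint atleast (k : nat) g a b : Prop :=
  if k is k'.+1 then exists2 x, zeros_in g a b x & atleast k' g x b else True.

Lemma atleast_mono k g a a' b b' : a' <= a -> b <= b' ->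
  atleast k g a b -> atleast k g a' b'.
Proof.
elim: k a a' => //= k IH a a' aa bb [x [/andP[ax xb] gx] H]; exists x; last exact: IH H.
by split => //; rewrite (le_lt_trans aa ax) (lt_le_trans xb bb).
Qed.

Lemma atleastP k g a b : atleast k g a b <->
  exists2 s : seq R, size s = k & path <%R a s /\ {in s, forall x, x < b /\ g x = 0}.
Proof.
elim: k a => [|k IH] a /=; first by split => // _; exists [::].
split.
  move=> [x [/andP[ax xb] gx]] /IH [s sk [ps sb]]; exists (x :: s); first by rewrite /= sk.
  by split; [rewrite /= ax|move=> y /[!inE] /orP[/eqP->|/sb]].
move=> [[//|x s] [sk] [/= /andP[ax ps] sb]]; exists x.
  by have [xb gx] := sb x (mem_head _ _); rewrite /zeros_in/= ax xb.
by apply/IH; exists s => //; split => // y ys; apply: sb; rewrite inE ys orbT.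
Qed.

Lemma atleast_fset g a b (B : {fset R}) : [set` B] `<=` zeros_in g a b ->
  atleast #|` B| g a b.
Proof.
move=> BZ; apply/atleastP; exists (sort <=%R (enum_fset B)).
  by rewrite size_sort.
split; last by move=> x; rewrite mem_sort => /BZ[/andP[_ ->] ->].
rewrite lt_path_sortedE lt_sorted_uniq_le sort_uniq fset_uniq sort_le_sorted !andbT.
by apply/allP => x; rewrite mem_sort => /BZ[/andP[->]].
Qed.

Lemma atleast_leq k l g a b : (k <= l)%N -> atleast l g a b -> atleast k g a b.
Proof.
by elim: k l a => // k IH [//|l] a /= kl [x zx H]; exists x => //; exact: IH H.
Qed.

Lemma atleast_infinite k g a b : infinite_set (zeros_in g a b) -> atleast k g a b.
Proof.
move=> /(@infinite_set_fset _ _ k)[B BZ kB].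
exact: atleast_leq kB (atleast_fset BZ).
Qed.

Lemma atleast_count k g a b : finite_set (zeros_in g a b) ->
  atleast k g a b <-> (k <= zero_count g a b)%N.
Proof.
move=> fZ; split.
  move=> /atleastP[s sk [ps sb]]; rewrite -sk /zero_count.
  have us : uniq s.
    by move: ps; rewrite lt_path_sortedE => /andP[_]; rewrite lt_sorted_uniq_le => /andP[].
  apply: (@uniq_leq_size _ s (enum_fset _)) => // x xs.
  rewrite in_fset_set// inE; have [xb gx] := sb x xs; split => //.
  rewrite xb andbT; move: ps; rewrite lt_path_sortedE => /andP[/allP/(_ x xs)].
  by [].
move=> kZ; apply: atleast_leq kZ _; apply: atleast_fset => x /=.
by rewrite in_fset_set// inE.
Qed.

Lemma zero_count_infinite g a b : infinite_set (zeros_in g a b) -> zero_count g a b = 0%N.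
Proof. by move=> iZ; rewrite /zero_count /fset_set; case: pselect => // _; exact: cardfs0. Qed.

(** Makes room for a rational between one zero and the next. *)
Lemma atleastS_gt k g a b : a < b -> atleast k g a b -> exists2 y, a < y < b & atleast k g y b.
Proof.
case: k => [|k] ab /=.
  by exists ((a + b) / 2); rewrite ?midf_lt//.
move=> [x [/andP[ax xb] gx] H]; exists ((a + x) / 2).
  by have [-> h] := midf_lt ax; rewrite (lt_trans h xb).
by exists x => //; rewrite /zeros_in/= (midf_lt ax).2 xb.
Qed.

(** * Measurability of the zero count *)

Section Measurability.
Context d (T : measurableType d) (f : T -> R -> R).
Hypothesis cf : forall w, continuous (f w).
Hypothesis mf : forall x, measurable_fun setT (f^~ x).

(** A zero in [c, e] exists exactly when |f w| goes below every 1/(m+1) at rational points of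
    [c, e]: continuity and density give one direction, the minimum of |f w| on the compact interval
    the other. As c < e, rationals of the interval also approach a zero at an endpoint. *)
Lemma measurable_zero_itv (c e : R) : c < e ->
  measurable [set w | exists2 x, c <= x <= e & f w x = 0].
Proof.
move=> ce.
pose F (m : nat) (q : rat) : set T :=
  if c <= ratr q <= e then [set w | `|f w (ratr q)| < m.+1%:R^-1] else set0.
have -> : [set w | exists2 x, c <= x <= e & f w x = 0] = \bigcap_m \bigcup_q F m q.
  apply/seteqP; split => w /=.
    move=> [x /andP[cx xe] fx] m _.
    have cfx : f w t @[t --> x] --> f w x := @cf w x.
    move/cvgrPdist_lt/(_ m.+1%:R^-1) : cfx.
    rewrite invr_gt0 ltr0n => /(_ isT); rewrite near_nbhs => -[r /= r0 H].
    have [q] : exists q : rat, ratr q \in `]Num.max c (x - r), Num.min e (x + r)[.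
      by apply: rat_in_itvoo; rewrite gt_max !lt_min ce/=; apply/and3P; split; [lra|lra|lra].
    rewrite in_itv/= gt_max lt_min => /andP[/andP[q1 q2] /andP[q3 q4]].
    exists q => //; rewrite /F (ltW q1) (ltW q3)/=.
    have := H (ratr q); rewrite /= fx sub0r normrN; apply.
    by rewrite ltr_distlC; lra.
  move=> H.
  have : exists2 y, y \in `[c, e] & forall t, t \in `[c, e] -> `|f w y| <= `|f w t|.
    apply: (@EVT_min _ (fun t => `|f w t|)); first exact: ltW.
    apply: continuous_subspaceT => x; apply: continuous_comp; first exact: cf.
    exact: norm_continuous.
  move=> [y yce ymin]; exists y; first by move: yce; rewrite in_itv.
  apply/eqP; rewrite -normr_eq0 eq_le normr_ge0 andbT leNgt; apply/negP => y0.
  have [m _ Hm] := near_infty_natSinv_lt (PosNum y0).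
  have [q _] := H m I; rewrite /F; case: ifPn => // qce /= fq.
  have := ymin (ratr q); rewrite in_itv/= => /(_ qce) /le_lt_trans /(_ fq) h1.
  by have := lt_trans h1 (Hm m (leqnn m)); rewrite /= ltxx.
apply: bigcapT_measurable => m; apply: bigcupT_measurable_rat => q.
rewrite /F; case: ifPn => // _.
have mg : measurable_fun setT (fun w => `|f w (ratr q)|).
  by apply: measurableT_comp => //; exact: mf.
have := mg measurableT _ (measurable_itv `]-oo, m.+1%:R^-1[).
rewrite setTI; congr (measurable _); apply/seteqP; split => w /=; rewrite in_itv//.
Qed.

(** One zero is enclosed between rationals p < q and the k remaining ones are sought to the right of
    q, which gives a countable union. *)
Lemma measurable_atleast k a b : measurable [set w | atleast k (f w) a b].
Proof.
elim: k a => [|k IH] a.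
  by rewrite (_ : [set _ | _] = setT)//; exact/seteqP.
pose F (p q : rat) : set T :=
  if (a < (ratr p : R) < ratr q) && ((ratr q : R) < b) then
    [set w | exists2 x, ratr p <= x <= ratr q & f w x = 0] `&` [set w | atleast k (f w) (ratr q) b]
  else set0.
have -> : [set w | atleast k.+1 (f w) a b] = \bigcup_p \bigcup_q F p q.
  apply/seteqP; split => w /=.
    move=> [x [/andP[ax xb] fx] H].
    have [y /andP[xy yb] Hy] := atleastS_gt xb H.
    have [p] := rat_in_itvoo ax; rewrite in_itv/= => /andP[ap px].
    have [q] := rat_in_itvoo xy; rewrite in_itv/= => /andP[xq qy].
    exists p => //; exists q => //; rewrite /F ap (lt_trans px xq) (lt_trans qy yb)/=.
    split; first by exists x => //; rewrite !ltW.
    by apply: atleast_mono Hy => //; exact: ltW.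
  move=> [p _ [q _]]; rewrite /F; case: ifPn => // /andP[/andP[ap pq] qb] [[x /andP[px xq] fx] H].
  exists x; last by apply: atleast_mono H.
  by rewrite /zeros_in/= (lt_le_trans ap px) (le_lt_trans xq qb).
apply: bigcupT_measurable_rat => p; apply: bigcupT_measurable_rat => q.
rewrite /F; case: ifPn => // /andP[/andP[_ pq] _].
by apply: measurableI => //; exact: measurable_zero_itv.
Qed.

(** The count is 0 when there are infinitely many zeros, so the event that it is at least l+1 is the
    event of having l+1 zeros minus that of having infinitely many. By the hypothesis the latter is
    the event of having m zeros; m = n+1 will serve for forms of degree n. *)
Lemma measurable_zero_count (m : nat) a b :
  (forall w, atleast m (f w) a b -> infinite_set (zeros_in (f w) a b)) ->
  forall k, measurable [set w | zero_count (f w) a b = k].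
Proof.
move=> inf k.
pose A k := [set w | (k <= zero_count (f w) a b)%N].
have mA l : measurable (A l).
  case: l => [|l]; first by rewrite (_ : A 0%N = setT)//; exact/seteqP.
  rewrite (_ : A l.+1 = [set w | atleast l.+1 (f w) a b] `\` [set w | atleast m (f w) a b]).
    by apply: measurableD; exact: measurable_atleast.
  apply/seteqP; split => w; rewrite /A /=.
    have [fi|/zero_count_infinite ->//] := pselect (finite_set (zeros_in (f w) a b)).
    by move=> /(atleast_count _ fi); split => // /inf.
  move=> [H1 H2]; apply/atleast_count => //.
  by apply: contrapT => /(@atleast_infinite m).
rewrite (_ : [set w | _] = A k `\` A k.+1); first exact: measurableD.
apply/seteqP; split => w; rewrite /A /=; first by move=> ->; rewrite ltnn.
by move=> [h1 /negP]; rewrite -leqNgt => h2; apply/eqP; rewrite eqn_leq h1 h2.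
Qed.

End Measurability.
End ZeroCount.

(** * Random variables with finitely many integer values *)

Section FiniteExpectation.
Context d (T : measurableType d) (R : realType) (P : probability T R).
Variables (X : T -> nat) (n : nat).
Hypothesis mX : forall k, measurable [set w | X w = k].
Hypothesis Xn : forall w, (X w <= n)%N.

Definition pmass (j : 'I_n.+1) : R := fine (P [set w | X w = j]).

Lemma expectation_finite (h : nat -> R) :
  'E_P[fun w => h (X w)]%E = (\sum_(j < n.+1) pmass j * h j)%:E.
Proof.
rewrite unlock.
have -> : (fun w => (h (X w))%:E) =
   (fun w => (\sum_(j < n.+1) ((h j) * \1_[set w | X w = j] w)%:E)%E).
  apply/funext => w; rewrite (bigD1 (Ordinal (Xn w : X w < n.+1)%N))//= big1 ?adde0.
    by rewrite indicE mem_set// mulr1.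
  move=> j jX; rewrite indicE memNset ?mulr0//= => XE.
  by move/eqP: jX; apply; apply/val_inj.
have fin A : measurable A -> P.-integrable setT (EFin \o \1_A : T -> \bar R).
  by move=> mA; apply: integrable_indic => //; rewrite setTI// ltey_eq fin_num_measure.
have int (j : 'I_n.+1) : P.-integrable setT (fun w => (h j * \1_[set w | X w = j] w)%:E).
  have := integrableZl measurableT (h j) (fin _ (mX j)).
  by apply: eq_integrable => // w _; rewrite EFinM.
rewrite (integral_sum measurableT int).
rewrite -sumEFin; apply: eq_bigr => j _.
under eq_integral do rewrite EFinM.
rewrite (integralZl measurableT (fin _ (mX j))).
rewrite integral_indic// setIT [in RHS]mulrC EFinM /pmass fineK//.
exact: fin_num_measure.
Qed.

Lemma pmass_ge0 j : 0 <= pmass j.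
Proof. by rewrite fine_ge0. Qed.

Lemma pmass_sum : \sum_j pmass j = 1.
Proof.
have := expectation_finite (fun=> 1); rewrite expectation_cst => -[->].
by apply: eq_bigr => j _; rewrite mulr1.
Qed.

Let Y w : R := (X w)%:R.

Lemma mean_finite : mean P Y = \sum_j pmass j * j%:R.
Proof. by rewrite /mean (expectation_finite (fun j => j%:R)). Qed.

Lemma mean_moment_finite (a : R) k :
  mean P (fun w => (Y w - a) ^+ k) = moment_about pmass a k.
Proof. by rewrite /mean (expectation_finite (fun j => (j%:R - a) ^+ k)). Qed.

Lemma cumulant_finite k :
  cumulant P k Y = derive1n k (fun t => ln (\sum_(l < n.+1) pmass l * expR (t * l%:R))) 0.
Proof.
congr (derive1n k _ 0); apply/funext => t; congr ln.
rewrite /mmt_gen_fun (_ : _ \o _ = fun w => expR (t * (X w)%:R)).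
  by rewrite (expectation_finite (fun j => expR (t * j%:R))).
by apply/funext => w /=; rewrite /Y mulrC.
Qed.

Lemma cumulant1_finite : cumulant P 1 Y = mean P Y.
Proof.
have := @moment_cumulant_rec R _ pmass 0 (fun i => cumulant P i Y) 0 pmass_ge0 pmass_sum cumulant_finite.
rewrite big_ord1 bin0 mul0rn subr0 mul1r /= => E.
have m0 : moment_about pmass 0 0 = 1.
  by rewrite /moment_about -pmass_sum; apply: eq_bigr => i _; rewrite mulr1.
move: E; rewrite m0 mulr1 => <-; rewrite mean_finite.
by apply: eq_bigr => i _; rewrite subr0.
Qed.

End FiniteExpectation.

(** * Rotation invariance of the plane Gaussian measure *)

Section PlaneGauss.
Context {R : realType}.
Local Open Scope ereal_scope.
Local Notation RT := (measurableTypeR R).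
Local Notation mu := (@lebesgue_measure R).

Lemma lebesgue_measure_translate (t : R) (A : set RT) : measurable A ->
  mu ((fun x : RT => (x + t)%R : RT) @^-1` A) = mu A.
Proof.
move=> mA; pose f := fun x : RT => (x + t)%R : RT.
have mf : measurable_fun [set: RT] f by exact: measurable_funD.
change (pushforward mu (f : RT -> RT) A = mu A).
apply/esym/(@lebesgue_measure_unique R (pushforward mu (f : RT -> RT))) => //= _ [[a b]] _ <-.
rewrite /pushforward.
have -> : f @^-1` [set` (`]a, b])%R] = [set` (`]a - t, b - t])%R].
  by apply/seteqP; split => x /=; rewrite !in_itv /= /f ltrBlDr lerBrDr.
rewrite !lebesgue_measure_itv /= !lte_fin ltrD2r; case: ifP => // _.
by rewrite -!EFinD; congr EFin; ring.
Qed.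

Let mu2 := mu \x mu.

Definition shear1 (a : R) (z : RT * RT) : RT * RT := (z.1, (z.2 + a * z.1)%R).
Definition shear2 (a : R) (z : RT * RT) : RT * RT := ((z.1 + a * z.2)%R, z.2).
Definition rot2 (c s : R) (z : RT * RT) : RT * RT :=
  ((c * z.1 - s * z.2)%R, (s * z.1 + c * z.2)%R).

Lemma measurable_lin2 (a b : R) :
  measurable_fun setT (fun z : RT * RT => (a * z.1 + b * z.2)%R : RT).
Proof.
apply: (@measurable_funD _ _ R _ (fun z : RT * RT => (a * z.1)%R) (fun z => (b * z.2)%R)).
  by apply: (@measurable_funM _ _ R _ (cst a) fst).
by apply: (@measurable_funM _ _ R _ (cst b) snd).
Qed.

Lemma measurable_shear1 a : measurable_fun setT (shear1 a).
Proof.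
apply/measurable_fun_pairP; split; first exact: measurable_fst.
have := measurable_lin2 a 1; congr measurable_fun.
by apply/funext => z /=; rewrite mul1r addrC.
Qed.

Lemma measurable_shear2 a : measurable_fun setT (shear2 a).
Proof.
apply/measurable_fun_pairP; split; last exact: measurable_snd.
have := measurable_lin2 1 a; congr measurable_fun.
by apply/funext => z /=; rewrite mul1r.
Qed.

Lemma measurable_rot2 c s : measurable_fun setT (rot2 c s).
Proof.
apply/measurable_fun_pairP; split; last exact: measurable_lin2.
have := measurable_lin2 c (- s); congr measurable_fun.
by apply/funext => z /=; rewrite mulNr.
Qed.

(** The shear translates each vertical section, and the product measure integrates the lengths of
    these sections. *)
Lemma shear1_invariant a C : measurable C -> mu2 (shear1 a @^-1` C) = mu2 C.
Proof.
move=> mC; apply: eq_integral => x _ /=.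
rewrite -(@lebesgue_measure_translate (a * x) (xsection C x)); last exact: measurable_xsection.
by congr (mu _); apply/seteqP; split => y /=; rewrite /xsection /= !inE.
Qed.

Lemma swap_invariant C : measurable C -> mu2 ((@swap_pair RT RT) @^-1` C) = mu2 C.
Proof.
move=> mC; have ms : measurable_fun setT (@swap_pair RT RT) by exact: measurable_swap.
apply/esym/(@product_measure_unique _ _ _ _ _ mu mu (pushforward mu2 (@swap_pair RT RT))) => // A B mA mB.
transitivity (mu2 (B `*` A)).
  by congr mu2; apply/seteqP; split => -[x y] /= [].
by rewrite /mu2 product_measure1E// muleC.
Qed.

Lemma shear2_invariant a C : measurable C -> mu2 (shear2 a @^-1` C) = mu2 C.
Proof.
move=> mC.
have mS : measurable ((@swap_pair RT RT) @^-1` C).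
  by rewrite -[X in measurable X]setTI; exact: measurable_swap.
have mS' : measurable (shear1 a @^-1` (@swap_pair RT RT @^-1` C)).
  by rewrite -[X in measurable X]setTI; exact: measurable_shear1.
by rewrite -(swap_invariant mC) -(shear1_invariant a mS) -(swap_invariant mS').
Qed.

(** For the angle phi with c = cos phi and s = sin phi, s / (1 + c) is tan(phi/2): a rotation is a
    product of three shears, of parameters -tan(phi/2), sin phi, -tan(phi/2). The half-turn c = -1
    is excluded. Rotation invariance of the plane measure thus follows from translation invariance
    on the line. *)
Lemma rot2_shear (c s : R) : (c ^+ 2 + s ^+ 2 = 1)%R -> (-1 < c)%R ->
  let t := (- (s / (1 + c)))%R in rot2 c s = shear2 t \o (shear1 s \o shear2 t).
Proof.
move=> cs c1 t; apply/funext => -[x y]; rewrite /rot2 /shear1 /shear2 /=.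
have c0 : (1 + c != 0)%R by rewrite gt_eqF//; lra.
have ts : (t * s = c - 1)%R.
  rewrite /t; apply: (mulIf c0); have -> : ((c - 1) * (1 + c) = c ^+ 2 - 1)%R by ring.
  have -> : (c ^+ 2 = 1 - s ^+ 2)%R by rewrite -cs; ring.
  by field.
have tc : (t * (1 + c) = - s)%R by rewrite /t; field.
congr pair.
  have -> : (x + t * y + t * (y + s * (x + t * y)) = x + (t * s) * x + t * (1 + (1 + t * s)) * y)%R by ring.
  rewrite ts (_ : 1 + (1 + (c - 1)) = 1 + c)%R; last by ring.
  by rewrite tc; ring.
have -> : (y + s * (x + t * y) = s * x + (1 + t * s) * y)%R by ring.
by rewrite ts; ring.
Qed.

Lemma rot2_invariant (c s : R) C : (c ^+ 2 + s ^+ 2 = 1)%R -> (-1 < c)%R ->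
  measurable C -> mu2 (rot2 c s @^-1` C) = mu2 C.
Proof.
move=> cs c1 mC; rewrite rot2_shear//= comp_preimage comp_preimage.
set t := (- _)%R.
have m2 : measurable (shear2 t @^-1` C).
  by rewrite -[X in measurable X]setTI; exact: measurable_shear2.
have m1 : measurable (shear1 s @^-1` (shear2 t @^-1` C)).
  by rewrite -[X in measurable X]setTI; exact: measurable_shear1.
by rewrite shear2_invariant// shear1_invariant// shear2_invariant.
Qed.

Local Notation phi := (normal_pdf (0 : R) 1).

(** Given by its density rather than as a product of two laws: the density is radial, so that
    rotations only have to be studied on Lebesgue measure. The product form on rectangles comes back
    in [gauss2_setX]. *)
Definition gauss2 (C : set (RT * RT)) : \bar R :=
  \int[mu2]_(z in C) (phi z.1 * phi z.2)%:E.

Let phi2_ge0 (z : RT * RT) : 0 <= (phi z.1 * phi z.2)%:E.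
Proof. by rewrite lee_fin mulr_ge0// normal_pdf_ge0. Qed.

Let measurable_phi2 : measurable_fun setT (fun z : RT * RT => (phi z.1 * phi z.2)%:E).
Proof.
apply/measurable_EFinP; apply: measurable_funM => /=.
  by apply: (measurableT_comp (f := phi)) => //; exact: measurable_normal_pdf.
by apply: (measurableT_comp (f := phi)) => //; exact: measurable_normal_pdf.
Qed.

Let gauss2_0 : gauss2 set0 = 0.
Proof. exact: integral_set0. Qed.

Let gauss2_ge0 C : 0 <= gauss2 C.
Proof. exact: integral_ge0. Qed.

Let gauss2_sigma_additive : semi_sigma_additive gauss2.
Proof.
move=> /= A mA tA mUA.
rewrite /gauss2 ge0_integral_bigcup//; last exact: measurable_funTS.
apply: is_cvg_ereal_nneg_natsum_cond => n _ _.
exact: integral_ge0.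
Qed.

HB.instance Definition _ := isMeasure.Build _ _ _
  gauss2 gauss2_0 gauss2_ge0 gauss2_sigma_additive.

Local Notation gamma := (normal_prob (0 : R) 1).

Lemma gauss2_setX (A B : set RT) : measurable A -> measurable B ->
  gauss2 (A `*` B) = gamma A * gamma B.
Proof.
move=> mA mB; rewrite /gauss2 /normal_prob integral_mkcond.
have mg (D : set RT) : measurable D ->
    measurable_fun setT (fun x : RT => (phi x * \1_D x)%:E).
  move=> mD; apply/measurable_EFinP; apply: measurable_funM => //=.
  exact: measurable_normal_pdf.
have g0 (D : set RT) x : 0 <= (phi x * \1_D x)%:E.
  by rewrite lee_fin mulr_ge0// normal_pdf_ge0.
rewrite (_ : _ \_ _ = fun z => (phi z.1 * \1_A z.1)%:E * (phi z.2 * \1_B z.2)%:E); last first.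
  apply/funext => -[x y]; rewrite patchE /= -EFinM in_setX /= !indicE.
  by case: (x \in A); case: (y \in B); rewrite /= ?mulr1 ?mulr0 ?mul0r.
rewrite fubini_tonelli1//=; last 2 first.
- apply: emeasurable_funM.
    by apply: (measurableT_comp (f := fun x => (phi x * \1_A x)%:E)) => //; exact: mg.
  by apply: (measurableT_comp (f := fun x => (phi x * \1_B x)%:E)) => //; exact: mg.
- by move=> z; rewrite mule_ge0.
rewrite /fubini_F /=.
under eq_integral => x _ do
  rewrite (ge0_integralZl _ measurableT (mg _ mB) (fun y _ => g0 B y) (g0 A x)).
rewrite (ge0_integralZr _ measurableT (mg _ mA) (fun y _ => g0 A y)); last first.
  by apply: integral_ge0.
by congr (_ * _); rewrite [RHS]integral_mkcond; apply: eq_integral => x _;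
  rewrite patchE indicE; case: (x \in _); rewrite ?mulr1 ?mulr0.
Qed.

Lemma normal_pdf_mul (x y : R) :
  (phi x * phi y = normal_peak 1 ^+ 2 * expR (- (x ^+ 2 + y ^+ 2) / 2))%R.
Proof.
rewrite !normal_pdfE ?oner_eq0//= /normal_fun !subr0 mulrACA -expRD -expr2.
by congr (_ * expR _)%R; rewrite expr1n; field.
Qed.

Lemma gauss2_rot2 (c s : R) C : (c ^+ 2 + s ^+ 2 = 1)%R -> (-1 < c)%R ->
  measurable C -> gauss2 (rot2 c s @^-1` C) = gauss2 C.
Proof.
move=> cs c1 mC; rewrite /gauss2.
pose Phi := fun z : RT * RT => (phi z.1 * phi z.2)%:E.
have PhiE : Phi = Phi \o rot2 c s.
  apply/funext => -[x y]; rewrite /Phi /= !normal_pdf_mul.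
  congr (_ * expR _)%:E; congr (- _ / 2)%R.
  have -> : ((c * x - s * y) ^+ 2 + (s * x + c * y) ^+ 2 =
             (c ^+ 2 + s ^+ 2) * (x ^+ 2 + y ^+ 2))%R by ring.
  by rewrite cs mul1r.
have mPhi : measurable_fun C Phi by exact: measurable_funTS.
have := ge0_integral_pushforward (measurable_rot2 c s) mu2 mC mPhi (fun z _ => phi2_ge0 z).
rewrite -PhiE => <-.
apply: eq_measure_integral; first exact: measurable_rot2.
move=> mrot A mA _.
exact: (rot2_invariant cs c1 mA).
Qed.

End PlaneGauss.

(** * Standard Gaussian vectors *)

Section GaussianVectors.
Context {R : realType}.
Local Notation RT := (measurableTypeR R).
Local Notation gamma := (normal_prob (0 : R) 1).

Lemma normal_probN (A : set RT) : measurable A ->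
  gamma ((fun x : RT => - x : RT) @^-1` A) = gamma A.
Proof.
move=> mA; rewrite /normal_prob.
pose Phi := fun x : RT => (normal_pdf (0 : R) 1 x)%:E.
have PhiE : Phi = Phi \o (fun x : RT => - x : RT).
  apply/funext => x; rewrite /Phi /= !normal_pdfE ?oner_eq0//= /normal_fun !subr0.
  by rewrite sqrrN.
have mN : measurable_fun setT (fun x : RT => - x : RT) by exact: measurable_funN.
have mPhi : measurable_fun A Phi.
  by apply: measurable_funTS; apply/measurable_EFinP; exact: measurable_normal_pdf.
have Phi0 : {in A, forall y, (0 <= Phi y)%E}.
  by move=> x _; rewrite lee_fin normal_pdf_ge0.
have := ge0_integral_pushforward mN (@lebesgue_measure R) mA mPhi Phi0.
rewrite -PhiE => <-.
apply: eq_measure_integral => B mB _.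
exact: lebesgue_measureN.
Qed.

(** Independent standard Gaussian coordinates under a finite measure of any mass. The notion then
    survives restriction of the measure to an event about one coordinate, which acts as conditioning
    without normalisation. *)
Definition giid d (T : measurableType d) (mu : set T -> \bar R) m (X : T -> 'rV[R]_m) :=
  [/\ (mu setT < +oo)%E,
      forall i, measurable_fun setT (fun w => X w 0 i) &
      forall A : 'I_m -> set RT, (forall i, measurable (A i)) ->
        mu [set w | forall i, A i (X w 0 i)] = (mu setT * \prod_(i < m) gamma (A i))%E].

(** Quantified over every space and measure, so that an induction on the dimension may use it for a
    restricted measure. *)
Definition preserves_giid m (A : 'M[R]_m) := forall d (T : measurableType d)
  (mu : {measure set T -> \bar R}) (X : T -> 'rV[R]_m),
  giid mu X -> giid mu (fun w => X w *m A).

Lemma measurable_mulmx_coord d (T : measurableType d) m n (X : T -> 'rV[R]_m) (A : 'M[R]_(m, n)) :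
  (forall i, measurable_fun setT (fun w => X w 0 i)) ->
  forall j, measurable_fun setT (fun w => (X w *m A) 0 j).
Proof.
move=> mX j; under eq_fun do rewrite mxE.
apply: measurable_sum => i; apply: measurable_funM => //.
Qed.

Lemma measurable_coords d (T : measurableType d) m (X : T -> 'rV[R]_m) (A : 'I_m -> (set RT)) :
  (forall i, measurable_fun setT (fun w => X w 0 i)) -> (forall i, measurable (A i)) ->
  measurable [set w | forall i, A i (X w 0 i)].
Proof.
move=> mX mA.
rewrite (_ : [set w | _] = \bigcap_(i in [set: 'I_m]) ((fun w => X w 0 i) @^-1` (A i))); last first.
  by apply/seteqP; split => w /= h i; [move=> _; exact: h|exact: (h i)].
apply: fin_bigcap_measurable; first exact: finite_finset.
by move=> i _; rewrite -[X in measurable X]setTI; exact: (mX i measurableT _ (mA i)).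
Qed.

Lemma preserves_giid_mul m (A B : 'M[R]_m) :
  preserves_giid A -> preserves_giid B -> preserves_giid (A *m B).
Proof.
move=> pA pB d T mu X gX; have := pB _ _ _ _ (pA _ _ _ _ gX).
by congr giid; apply/funext => w; rewrite mulmxA.
Qed.

Let cons_fam (S : Type) m (a : S) (A : 'I_m -> S) (i : 'I_m.+1) : S :=
  oapp A a (unlift ord0 i).

Let cons_fam0 (S : Type) m (a : S) (A : 'I_m -> S) : cons_fam a A ord0 = a.
Proof. by rewrite /cons_fam unlift_none. Qed.

Let cons_famS (S : Type) m (a : S) (A : 'I_m -> S) i : cons_fam a A (lift ord0 i) = A i.
Proof. by rewrite /cons_fam liftK. Qed.

Let forall_ordS m (Q : 'I_m.+1 -> Prop) :
  (forall i, Q i) <-> Q ord0 /\ forall i, Q (lift ord0 i).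
Proof.
split=> [h|[h0 hS] i]; first by split => *; exact: h.
by case: (unliftP ord0 i) => [j|] ->.
Qed.

Lemma giid_tail d (T : measurableType d) (mu : {measure set T -> \bar R}) m
    (X : T -> 'rV[R]_m.+1) (C : set RT) (mC : measurable C)
    (mD : measurable [set w | C (X w 0 ord0)]) :
  giid mu X ->
  mu [set w | C (X w 0 ord0)] = (mu setT * gamma C)%E /\
  giid (mrestr mu mD) (fun w => \row_i X w 0 (lift ord0 i)).
Proof.
move=> [fmu mX gX].
have muD : mu [set w | C (X w 0 ord0)] = (mu setT * gamma C)%E.
  have := gX (cons_fam C (fun=> setT)).
  rewrite big_ord_recl cons_fam0 big1 ?mule1; last first.
    by move=> i _; rewrite cons_famS; exact: (@probability_setT _ _ _ (normal_prob (0 : R) 1)).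
  move=> <-; last by apply/forall_ordS; split => [|i]; rewrite ?cons_fam0 ?cons_famS.
  congr (mu _); apply/seteqP; split => w /=.
    by move=> Cw; apply/forall_ordS; split => [|i]; rewrite ?cons_fam0 ?cons_famS.
  by move=> /forall_ordS[]; rewrite cons_fam0.
split => //; split.
- rewrite /mrestr setTI (le_lt_trans _ fmu)//; apply: le_measure => //; rewrite ?inE//.
- move=> i; under eq_fun do rewrite mxE.
  exact: mX.
- move=> A mA; rewrite /mrestr setTI muD -muleA.
  have := gX (cons_fam C A); rewrite big_ord_recl cons_fam0.
  under eq_bigr do rewrite cons_famS.
  move=> <-; last by apply/forall_ordS; split => [|i]; rewrite ?cons_fam0 ?cons_famS.
  congr (mu _); apply/seteqP; split => w /=.
    move=> [h Cw]; apply/forall_ordS; split => [|i]; rewrite ?cons_fam0 ?cons_famS//.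
    by have := h i; rewrite mxE.
  move=> /forall_ordS[]; rewrite cons_fam0 => Cw h; split => // i.
  by have := h i; rewrite cons_famS mxE.
Qed.

Lemma row_cons m (u : 'rV[R]_(1 + m)) :
  u = row_mx (u 0 ord0)%:M (\row_i u 0 (lift ord0 i)).
Proof.
rewrite -[LHS]hsubmxK; congr row_mx; apply/rowP => i; rewrite !mxE.
  by rewrite (ord1 i) mulr1n; congr (u 0 _); apply/val_inj.
by congr (u 0 _); apply/val_inj.
Qed.

(** The scalar e is 1 or -1, and a sign is absorbed by the symmetry of the normal law. The other
    coordinates are transformed by A under the measure restricted to the event on the first one. *)
Lemma preserves_giid_block m (A : 'M[R]_m) (e : R) : e ^+ 2 = 1 -> preserves_giid A ->
  preserves_giid (block_mx e%:M 0 0 A : 'M[R]_(1 + m)).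
Proof.
move=> e1 pA d T mu X gX; have [fmu mX hX] := gX.
split => //; first exact: measurable_mulmx_coord.
move=> B mB.
pose C : set RT := (fun x : RT => e * x : RT) @^-1` B ord0.
have mC : measurable C.
  have me : measurable_fun setT (fun x : RT => e * x : RT).
    by apply: (@measurable_funM _ _ R _ (cst e) id).
  by rewrite -[X in measurable X]setTI; exact: (me measurableT _ (mB ord0)).
have gC : gamma C = gamma (B ord0).
  have /orP[/eqP E|/eqP E] : (e == 1) || (e == -1) by rewrite -sqrf_eq1 e1.
    by congr (normal_prob _ _); apply/funext => x; rewrite /C /preimage /= E mul1r.
  rewrite -(normal_probN (mB ord0)); congr (normal_prob _ _).
  by apply/funext => x; rewrite /C /preimage /= E mulN1r.
have mD : measurable [set w | C (X w 0 ord0)].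
  by rewrite -[X in measurable X]setTI; exact: (mX ord0 measurableT _ mC).
have [muD gD] := giid_tail mC mD gX.
have [_ _ /(_ (fun i => B (lift ord0 i)) (fun i => mB _)) H] := pA _ _ _ _ gD.
rewrite big_ord_recl -gC muleA -muD.
transitivity (mrestr mu mD [set w | forall i, B (lift ord0 i)
  (((\row_i0 X w 0 (lift ord0 i0)) *m A) 0 i)]); last first.
  by rewrite [LHS]H; congr (_ * _)%E; rewrite /= /mrestr setTI.
have E w : X w *m block_mx e%:M 0 0 A =
    row_mx (e * X w 0 ord0)%:M ((\row_i0 X w 0 (lift ord0 i0)) *m A).
  rewrite [in LHS](row_cons (X w)) mul_row_block !mulmx0 addr0 add0r.
  by rewrite -scalar_mxM mulrC.
have l0 : ord0 = lshift m ord0 :> 'I_(1 + m) by exact/val_inj.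
have rS i : lift ord0 i = rshift 1 i :> 'I_(1 + m) by exact/val_inj.
congr (mu _); apply/seteqP; split => w /=; rewrite E.
  move=> /forall_ordS[]; rewrite l0 row_mxEl mxE eqxx mulr1n -l0 => h0 hS; split => //.
  by move=> i; have := hS i; rewrite [X in row_mx _ _ _ X]rS row_mxEr.
move=> [hS h0]; apply/forall_ordS; split.
  by rewrite l0 row_mxEl mxE eqxx mulr1n -l0.
by move=> i; rewrite [X in row_mx _ _ _ X]rS row_mxEr.
Qed.

End GaussianVectors.

(** * Rotations of two coordinates *)

Section Orthogonal.
Context {R : realType}.
Local Notation RT := (measurableTypeR R).
Local Notation gamma := (normal_prob (0 : R) 1).

Lemma rectangle_measure_unique (m1 m2 : {measure set (RT * RT) -> \bar R}) :
  (m1 setT < +oo)%E ->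
  (forall A B, measurable A -> measurable B -> m1 (A `*` B) = m2 (A `*` B)) ->
  forall C, measurable C -> m1 C = m2 C.
Proof.
move=> f1 E C mC.
pose G : set (set (RT * RT)) :=
  [set C | exists2 A, measurable A & exists2 B, measurable B & A `*` B = C].
apply: (measure_unique G (fun=> setT)) => //.
- by rewrite measurable_prod_measurableType.
- move=> _ _ [A mA [B mB <-]] [A' mA' [B' mB' <-]].
  exists (A `&` A'); first exact: measurableI.
  by exists (B `&` B'); [exact: measurableI|rewrite setXI].
- by move=> _; exists setT => //; exists setT => //; rewrite setXTT.
- by apply/seteqP; split => // x _; exists 0%N.
- by move=> _ [A mA [B mB <-]]; exact: E.
Qed.

Definition givens m (c s : R) : 'M[R]_(m.+2) := \matrix_(i, j)
  match nat_of_ord i, nat_of_ord j with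
  | 0, 0 => c | 0, 1 => s | 1, 0 => - s | 1, 1 => c
  | k.+2, l.+2 => (k == l)%:R | _, _ => 0 end.

Lemma mul_givens m c s (u : 'rV[R]_(m.+2)) j : (u *m givens m c s) 0 j =
  match nat_of_ord j with
  | 0 => c * u 0 ord0 - s * u 0 (lift ord0 ord0)
  | 1 => s * u 0 ord0 + c * u 0 (lift ord0 ord0)
  | _ => u 0 j end.
Proof.
rewrite mxE !big_ord_recl !mxE /=.
case: j => -[|[|j]] Hj /=.
- by rewrite big1 ?addr0 ?mulrN 1?mulrC 1?[u 0 _ * s]mulrC// => i _; rewrite mxE /= mulr0.
- by rewrite big1 ?addr0 1?mulrC 1?[u 0 _ * c]mulrC// => i _; rewrite mxE /= mulr0.
rewrite !mulr0 !add0r (bigD1 (Ordinal (Hj : j < m)%N))//= big1 ?addr0.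
  by rewrite mxE /= eqxx mulr1; congr (u 0 _); apply/val_inj.
move=> i ij; rewrite mxE /=; case: eqP => [E|]; rewrite ?mulr0//.
by move/eqP: ij; case; apply/val_inj.
Qed.

Lemma tr_givens m c s : (givens m c s)^T = givens m c (- s).
Proof.
apply/matrixP => -[[|[|i]] hi] -[[|[|j]] hj]; rewrite !mxE //= ?opprK//.
by rewrite eq_sym.
Qed.

Lemma givens_orth m c s : c ^+ 2 + s ^+ 2 = 1 -> givens m c s *m (givens m c s)^T = 1%:M.
Proof.
move=> cs; apply/row_matrixP => i; rewrite row_mul tr_givens row1.
apply/rowP => j; rewrite mul_givens !mxE /=.
case: i => -[|[|i]] hi; case: j => -[|[|j]] hj //=;
  rewrite ?mulr0 ?addr0 ?subr0 //.
all: try by rewrite -?cs; ring.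
by rewrite [in LHS]eq_sym.
Qed.

Let mule_shuffle (a b c e : \bar R) : (a * (b * (c * e)) = a * e * (b * c))%E.
Proof. by rewrite -muleA [in RHS](muleC e) -muleA. Qed.

(** Restrict the measure to the event D that fixes the demands on all coordinates but the first two.
    The image of this restriction by the first two coordinates agrees with mu(D) times [gauss2] on
    rectangles, hence everywhere, and [gauss2] is invariant under the rotation. *)
Lemma preserves_giid_givens m c s : c ^+ 2 + s ^+ 2 = 1 -> -1 < c ->
  preserves_giid (givens m c s).
Proof.
move=> cs c1 d T mu X gX; have [fmu mX hX] := gX.
split => //; first exact: measurable_mulmx_coord.
move=> B mB.
pose i1 : 'I_m.+2 := lift ord0 ord0.
pose l2 (i : 'I_m) : 'I_m.+2 := lift ord0 (lift ord0 i).
pose fam (A A' : set RT) (i : 'I_m.+2) : set RT :=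
  match nat_of_ord i with 0 => A | 1 => A' | _ => B i end.
have ord2 (Q : 'I_m.+2 -> Prop) :
    (forall i, Q i) <-> [/\ Q ord0, Q i1 & forall i, Q (l2 i)].
  split => [h|[h0 h1 h2] i]; first by split => *; exact: h.
  case: (unliftP ord0 i) => [j|] -> //.
  by case: (unliftP ord0 j) => [k|] -> //; exact: h2.
pose D := [set w | forall i, B (l2 i) (X w 0 (l2 i))].
have mD : measurable D.
  have := @measurable_coords _ _ _ _ (fun w => \row_i X w 0 (l2 i)) (fun i => B (l2 i)) _ (fun i => mB _).
  have mX2 i : measurable_fun setT (fun w => (\row_i X w 0 (l2 i)) 0 i).
    by under eq_fun do rewrite mxE; exact: mX.
  move=> /(_ mX2); congr (measurable _).
  by apply/seteqP; split => w /= h i; have := h i; rewrite mxE.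
have muE (A A' : set RT) : measurable A -> measurable A' ->
    mu (D `&` [set w | A (X w 0 ord0) /\ A' (X w 0 i1)]) =
    (mu setT * (\prod_(i < m) gamma (B (l2 i))) * (gamma A * gamma A'))%E.
  move=> mA mA'; have mfam i : measurable (fam A A' i).
    by move: i; apply/ord2; split => // i; exact: mB.
  have := hX _ mfam; rewrite !big_ord_recl /fam /= mule_shuffle => <-.
  congr (mu _); apply/seteqP; split => w /=.
    by move=> [h [h0 h1]]; apply/ord2.
  by move=> /ord2[h0 h1 h2].
pose Z w : RT * RT := (X w 0 ord0, X w 0 i1).
have mZ : measurable_fun setT Z by apply/measurable_fun_pairP; split; exact: mX.
have muD : mu D = (mu setT * (\prod_(i < m) gamma (B (l2 i))))%E.
  have := muE setT setT measurableT measurableT.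
  rewrite (_ : D `&` _ = D); last by apply/seteqP; split => // w /= [].
  by rewrite !(@probability_setT _ _ _ (normal_prob (0 : R) 1)) !mule1.
pose nu := mrestr mu mD.
have finD : (mu D < +oo)%E by apply: le_lt_trans fmu; apply: le_measure; rewrite ?inE.
have D0 : 0 <= fine (mu D) by rewrite fine_ge0.
have muDE : mu D = (fine (mu D))%:E by rewrite fineK// ge0_fin_numE.
have key C : measurable C -> mu (D `&` Z @^-1` C) = (mu D * gauss2 C)%E.
  move=> mC.
  transitivity (pushforward nu Z C); first by rewrite /pushforward /nu /mrestr setIC.
  transitivity (mscale (NngNum D0) (@gauss2 R) C); last by rewrite [in RHS]muDE.
  apply: (@rectangle_measure_unique (pushforward nu Z) (mscale (NngNum D0) (@gauss2 R))) => //.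
    change (mu (Z @^-1` setT `&` D) < +oo)%E.
    by rewrite preimage_setT setTI.
  move=> A A' mA mA'.
  transitivity (mu D * gauss2 (A `*` A'))%E; last by rewrite [in LHS]muDE.
  rewrite gauss2_setX// muD -muE//; change (mu (Z @^-1` (A `*` A') `&` D) = mu (D `&` Z @^-1` (A `*` A'))).
  by rewrite setIC.
have mB01 : measurable (B ord0 `*` B i1) by exact: measurableX.
have mR : measurable (rot2 c s @^-1` (B ord0 `*` B i1)).
  by rewrite -[X in measurable X]setTI; exact: (measurable_rot2 c s measurableT mB01).
transitivity (mu (D `&` Z @^-1` (rot2 c s @^-1` (B ord0 `*` B i1)))).
  congr (mu _); apply/seteqP; split => w /=.
    by move=> /ord2[]; rewrite !mul_givens /= => h0 h1 h2; split => // i; have := h2 i; rewrite mul_givens.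
  by move=> [h2 [h0 h1]]; apply/ord2; split => [||i]; rewrite mul_givens//; exact: h2.
rewrite key// gauss2_rot2// gauss2_setX// muD !big_ord_recl /=.
by rewrite mule_shuffle.
Qed.

End Orthogonal.

(** * Invariance under the orthogonal group *)

Section OrthogonalGroup.
Context {R : realType}.
Local Notation RT := (measurableTypeR R).
Local Notation gamma := (normal_prob (0 : R) 1).

Lemma row_mx_gt0 m (x : 'M[R]_1) (j : 'I_(1 + m)) : (0 < j)%N -> row_mx x 0 0 j = 0.
Proof.
by case: (split_ordP j) => k ->; [rewrite (ord1 k)|rewrite row_mxEr mxE].
Qed.

Lemma row_mx_ord0 m (x : 'M[R]_1) (y : 'rV[R]_m) : row_mx x y 0 (ord0 : 'I_(1 + m)) = x 0 0.
Proof.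
have l0 : ord0 = lshift m ord0 :> 'I_(1 + m) by exact/val_inj.
by rewrite l0 row_mxEl.
Qed.

Lemma row_mx_lift m (x : 'M[R]_1) (y : 'rV[R]_m) i :
  row_mx x y 0 (lift ord0 i : 'I_(1 + m)) = y 0 i.
Proof.
have rS : lift ord0 i = rshift 1 i :> 'I_(1 + m) by exact/val_inj.
by rewrite [X in row_mx _ _ _ X]rS row_mxEr.
Qed.

Lemma preserves_giid1 m : preserves_giid (1%:M : 'M[R]_m).
Proof.
move=> d T mu X gX; rewrite (_ : (fun w => _) = X)//.
by apply/funext => w; rewrite mulmx1.
Qed.

Lemma block_orth m (A : 'M[R]_m) (e : R) : e ^+ 2 = 1 -> A *m A^T = 1%:M ->
  let B := block_mx e%:M 0 0 A : 'M[R]_(1 + m) in B *m B^T = 1%:M.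
Proof.
move=> e1 AA /=; rewrite tr_block_mx !trmx0 tr_scalar_mx mulmx_block !mulmx0 !mul0mx.
by rewrite !addr0 add0r AA -scalar_mxM -expr2 e1 -scalar_mx_block.
Qed.

(** By induction the entries after the first are gathered into the second, which a Givens rotation
    then clears. The Gaussian property is asked of [Q^T] because a matrix A will be recovered as (A
    Q) Q^T. *)
Lemma rotate_to_axis m (u : 'rV[R]_(1 + m)) : exists Q : 'M[R]_(1 + m),
  [/\ preserves_giid Q^T, Q *m Q^T = 1%:M & exists r : 'M[R]_1, u *m Q = row_mx r 0].
Proof.
elim: m u => [|m IH] u.
  exists 1%:M; split; rewrite ?trmx1 ?mulmx1//; first exact: preserves_giid1.
  by exists (lsubmx u); rewrite -[LHS]hsubmxK; congr row_mx; apply/rowP => -[].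
have [Q [pQ QQ [r Hr]]] := IH (rsubmx u).
pose a := u 0 ord0; pose b := r 0 0.
have [c [s [cs c1 sacb]]] : exists c s : R,
    [/\ c ^+ 2 + s ^+ 2 = 1, -1 < c & s * a + c * b = 0].
  pose rho := Num.sqrt (a ^+ 2 + b ^+ 2).
  have rho2 : rho ^+ 2 = a ^+ 2 + b ^+ 2 by rewrite sqr_sqrtr// addr_ge0// sqr_ge0.
  have [rho0|rho0] := eqVneq rho 0.
    exists 1, 0; split; rewrite ?expr1n ?expr0n ?addr0//.
    move: rho2; rewrite rho0 expr0n /= => /esym/eqP.
    by rewrite paddr_eq0 ?sqr_ge0// sqrf_eq0 mul0r mul1r add0r => /andP[_]; rewrite sqrf_eq0 => /eqP.
  have rho_gt0 : 0 < rho by rewrite lt_def rho0 sqrtr_ge0.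
  have [a0|a0] := leP 0 a.
    (* The condition s a + c b = 0 determines (c, s) up to sign; the sign making c nonnegative
       avoids the half-turn. *)
    exists (a / rho), (- b / rho); split.
    - rewrite !expr_div_n -mulrDl sqrrN -rho2 divff// expf_neq0//.
    - by apply: (@lt_le_trans _ _ 0); [lra|rewrite divr_ge0// ltW].
    - by field.
  exists (- a / rho), (b / rho); split.
  - rewrite !expr_div_n -mulrDl sqrrN -rho2 divff// expf_neq0//.
  - by apply: (@lt_le_trans _ _ 0); [lra|rewrite divr_ge0// ltW// oppr_cp0].
  - by field.
pose Q1 : 'M[R]_(1 + (1 + m)) := block_mx 1%:M 0 0 Q.
pose G : 'M[R]_(1 + (1 + m)) := givens m c s.
have G1 : G *m G^T = 1%:M by exact: givens_orth.
have Q11 : Q1 *m Q1^T = 1%:M by apply: block_orth => //; rewrite expr1n.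
exists (Q1 *m G); split.
- rewrite trmx_mul; apply: preserves_giid_mul.
    by rewrite /G tr_givens; apply: preserves_giid_givens => //; rewrite sqrrN.
  rewrite /Q1 tr_block_mx !trmx0 tr_scalar_mx.
  by apply: preserves_giid_block => //; rewrite expr1n.
- by rewrite trmx_mul mulmxA -(mulmxA Q1) G1 mulmx1.
exists (c * a - s * b)%:M; rewrite mulmxA.
have E : u *m Q1 = row_mx (lsubmx u) (row_mx r 0).
  by rewrite -[u in LHS]hsubmxK mul_row_block !mulmx0 addr0 add0r mulmx1 Hr.
have E0 : (u *m Q1) 0 ord0 = a.
  by rewrite E row_mx_ord0 mxE; congr (u 0 _); exact/val_inj.
have E1 : (u *m Q1) 0 (lift ord0 ord0) = b.
  by rewrite E row_mx_lift row_mx_ord0.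
apply/rowP => j; rewrite mul_givens E0 E1.
case: (unliftP ord0 j) => [k|] ->; last by rewrite row_mx_ord0 !mxE ?eqxx ?mulr1n.
rewrite row_mx_lift [RHS]mxE.
case: (unliftP ord0 k) => [l|] ->; last exact: sacb.
by rewrite E row_mx_lift row_mx_gt0.
Qed.

(** Once Q sends the first row of A to the axis, the orthogonal matrix A Q has first row (e, 0, ...,
    0). Orthogonality forces e^2 = 1 and clears the rest of the first column, so A Q is block
    diagonal and the induction applies to its lower block. *)
Theorem preserves_giid_orthogonal m (A : 'M[R]_m) : A *m A^T = 1%:M -> preserves_giid A.
Proof.
elim: m A => [|m IH] A AA.
  by rewrite (_ : A = 1%:M); [exact: preserves_giid1|apply/matrixP => -[]].
have [Q [pQ QQ [r Hr]]] := rotate_to_axis (row 0 A : 'rV[R]_(1 + m)).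
pose B : 'M[R]_(1 + m) := A *m Q.
have QtQ : Q^T *m Q = 1%:M by exact: mulmx1C.
have BB : B *m B^T = 1%:M.
  by rewrite /B trmx_mul mulmxA -(mulmxA A) QQ mulmx1.
have BQ : B *m Q^T = A by rewrite -mulmxA QQ mulmx1.
have rB : row 0 B = row_mx r 0 by rewrite row_mul Hr.
clearbody B.
have BE : B = block_mx (ulsubmx B) (ursubmx B) (dlsubmx B) (drsubmx B) by rewrite submxK.
have ur0 : ursubmx B = 0.
  move: rB => /rowP H; apply/matrixP => i j; have := H (rshift 1 j).
  rewrite row_mxEr !mxE => <-; congr (B _ _); apply/val_inj; by rewrite (ord1 i).
pose e := (ulsubmx B) 0 0.
have ulE : ulsubmx B = e%:M by rewrite [LHS]mx11_scalar.
move: BB; rewrite BE tr_block_mx mulmx_block ur0 !trmx0 !mulmx0 !mul0mx !addr0.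
rewrite scalar_mx_block => /eq_block_mx[].
rewrite ulE tr_scalar_mx -scalar_mxM => e1 _.
have e2 : e ^+ 2 = 1.
  by have /matrixP/(_ 0 0) := e1; rewrite !mxE eqxx !mulr1n expr2.
have e0 : e != 0 by apply: contra_eq_neq e2 => ->; rewrite expr0n eq_sym oner_eq0.
rewrite mul_mx_scalar => /eqP; rewrite scaler_eq0 (negbTE e0)/= => /eqP dl0.
rewrite dl0 mul0mx add0r => DD.
rewrite -BQ.
apply: preserves_giid_mul => //.
rewrite BE ur0 dl0 ulE; apply: preserves_giid_block => //; exact: IH.
Qed.

(** Tuples carry the product sigma-algebra on which laws are compared; rows serve for the matrix
    algebra. *)
Definition rowtuple m (v : 'rV[R]_m) : m.-tuple RT := [tuple v 0 i | i < m].

(** Boxes form a generating family stable under intersection, and both laws give them the same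
    product. *)
Lemma giid_law_unique d (T : measurableType d) (mu : {measure set T -> \bar R}) m
    (X Y : T -> 'rV[R]_m) (C : set (m.-tuple RT)) : giid mu X -> giid mu Y -> measurable C ->
  mu [set w | C (rowtuple (X w))] = mu [set w | C (rowtuple (Y w))].
Proof.
move=> [fmu mX gX] [_ mY gY] mC.
have mt (Z : T -> 'rV[R]_m) : (forall i, measurable_fun setT (fun w => Z w 0 i)) ->
    measurable_fun setT (fun w => rowtuple (Z w)).
  move=> mZ; apply/measurable_fun_tnthP => i.
  by have := mZ i; congr measurable_fun; apply/funext => w /=; rewrite tnth_mktuple.
pose G : set (set (m.-tuple RT)) := [set C | exists2 A : 'I_m -> set RT,
   (forall i, measurable (A i)) & C = [set t | forall i, A i (tnth t i)]].
have PE (Z : T -> 'rV[R]_m) A : [set w | [set t : m.-tuple RT | forall i, A i (tnth t i)] (rowtuple (Z w))] =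
    [set w | forall i : 'I_m, A i (Z w 0 i)].
  by apply/seteqP; split => w /= h i; have := h i; rewrite tnth_mktuple.
pose mX' := mt X mX; pose mY' := mt Y mY.
apply: (@measure_unique _ R _ G (fun=> setT) _ _ _ _
  (pushforward mu (fun w => rowtuple (X w))) (pushforward mu (fun w => rowtuple (Y w)))) => //.
- apply/seteqP; split.
    change (g_sigma_preimage (fun i (t : m.-tuple RT) => tnth t i) `<=` <<s G >>).
    apply: smallest_sub; first exact: smallest_sigma_algebra.
    apply: (@big_ind _ (fun S => S `<=` <<s G >>)) => //; first by move=> S S' hS hS' E [/hS|/hS'].
    move=> i _ _ [A mA <-]; apply: sub_sigma_algebra.
    exists (fun j => if j == i then A else setT).
      by move=> j; case: ifP.
    apply/seteqP; split => t /=.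
      by move=> [_ At] j; case: eqP => // ->.
    by move=> /(_ i); rewrite eqxx.
  apply: smallest_sub; first exact: sigma_algebra_measurable.
  move=> _ [A mA ->].
  rewrite (_ : [set t | _] = \bigcap_(i in [set: 'I_m]) ((fun t : m.-tuple RT => tnth t i) @^-1` (A i))); last first.
    by apply/seteqP; split => w /= h i; [move=> _; exact: h|exact: (h i)].
  apply: fin_bigcap_measurable; first exact: finite_finset.
  move=> i _; rewrite -[X in measurable X]setTI.
  have H := @measurable_tnth _ RT m i.
  exact: (H measurableT _ (mA i)).
- move=> _ _ [A mA ->] [A' mA' ->]; exists (fun i => A i `&` A' i).
    by move=> i; exact: measurableI.
  apply/seteqP; split => t /=; first by move=> [h h'] i; split.
  by move=> h; split => i; have [] := h i.
- by move=> _; exists (fun=> setT) => //; apply/seteqP; split.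
- by apply/seteqP; split => // x _; exists 0%N.
- move=> _ [A mA ->]; transitivity (mu setT * \prod_(i < m) gamma (A i))%E.
    by rewrite -gX//; congr (mu _); exact: PE.
  by rewrite -gY//; congr (mu _); rewrite -PE.
Qed.

End OrthogonalGroup.

(** * The elliptic polynomial as a trigonometric form *)

Section EllipticTrig.
Context {R : realType} (n : nat).
Implicit Types (v : 'rV[R]_n.+1) (x y t theta : R).

Definition binw (j : nat) : R := Num.sqrt ('C(n, j)%:R).

Lemma binw_gt0 (j : 'I_n.+1) : 0 < binw j.
Proof. by rewrite sqrtr_gt0 ltr0n bin_gt0 -ltnS. Qed.

Lemma binw2 j : binw j ^+ 2 = 'C(n, j)%:R.
Proof. by rewrite sqr_sqrtr. Qed.

Definition monomials x y : 'rV[R]_n.+1 := \row_j (binw j * x ^+ (n - j) * y ^+ j).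

Definition elliptic_form v x y : R := \sum_j v 0 j * monomials x y 0 j.

Definition trig_poly v theta : R := elliptic_form v (cos theta) (sin theta).

(** The elliptic polynomial with coefficient vector v. *)
Definition dehom v : {poly R} := \poly_(j < n.+1) (v 0 (inord j) * binw j).

Lemma size_dehom v : (size (dehom v) <= n.+1)%N.
Proof. exact: size_poly. Qed.

Lemma dehomE v t : (dehom v).[t] = elliptic_form v 1 t.
Proof.
rewrite horner_poly; apply: eq_bigr => j _.
by rewrite inord_val mxE expr1n mulr1 mulrA.
Qed.

Lemma elliptic_formZ v (c x y : R) : elliptic_form v (c * x) (c * y) = c ^+ n * elliptic_form v x y.
Proof.
rewrite mulr_sumr; apply: eq_bigr => j _; rewrite !mxE !exprMn.
have -> : c ^+ n = c ^+ (n - j) * c ^+ j by rewrite -exprD subnK// -ltnS.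
by ring.
Qed.

Lemma trig_poly_tan v theta : cos theta != 0 ->
  trig_poly v theta = cos theta ^+ n * (dehom v).[tan theta].
Proof.
move=> c0; rewrite dehomE -elliptic_formZ mulr1 /tan mulrCA divff// mulr1.
by [].
Qed.

Lemma poly_zero_fun (p : {poly R}) : (forall t, p.[t] = 0) -> p = 0.
Proof.
move=> p0; apply/eqP; apply/negPn/negP => pn0.
have := @max_poly_roots _ p [seq i%:R | i <- iota 0 (size p)] pn0.
rewrite size_map size_iota ltnn => H; suff : false by []; apply: H.
  by apply/allP => x _; rewrite /root p0.
by rewrite map_inj_uniq ?iota_uniq// => i j /eqP; rewrite eqr_nat => /eqP.
Qed.

Lemma dehom_eq0 v : dehom v = 0 -> v = 0.
Proof.
move=> /polyP H; apply/rowP => j; have := H j.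
rewrite coef_poly ltn_ord inord_val coef0 => /eqP; rewrite mulf_eq0.
by rewrite [binw j == 0]gt_eqF ?binw_gt0// orbF => /eqP ->; rewrite mxE.
Qed.

Lemma elliptic_form_mulmx v x y : elliptic_form v x y = (v *m (monomials x y)^T) 0 0.
Proof. by rewrite mxE; apply: eq_bigr => j _; rewrite [in RHS]mxE. Qed.

(** The binomial theorem. This is the covariance kernel of the Gaussian form, and thanks to the
    weights it depends on the two points only through their scalar product. *)
Lemma monomials_dot x y x' y' :
  monomials x y *m (monomials x' y')^T = ((x * x' + y * y') ^+ n)%:M.
Proof.
rewrite [LHS]mx11_scalar; congr (_%:M); rewrite exprDn mxE.
apply: eq_bigr => j _; rewrite !mxE -mulr_natr -binw2 !exprMn; ring.
Qed.

(* The action of the rotation of angle s on forms of degree n, in the basis of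
   weighted monomials. *)
Definition rotmx (s : R) : 'M[R]_n.+1 := \matrix_(i, j)
  ((((cos s)%:P - sin s *: 'X) ^+ (n - j) * ((sin s)%:P + cos s *: 'X) ^+ j)`_i * binw j / binw i).

Lemma monomials_rotmx s t :
  monomials (cos s - sin s * t) (sin s + cos s * t) = monomials 1 t *m rotmx s.
Proof.
apply/rowP => j; rewrite [LHS]mxE [RHS]mxE.
under eq_bigr do rewrite [rotmx s _ _]mxE.
set P := (_ ^+ (n - j) * (_ + cos s *: 'X) ^+ j).
have sz : (size P <= n.+1)%N.
  have jn : (j <= n)%N by rewrite -ltnS.
  have h (p : {poly R}) k : (size p <= 2)%N -> (size (p ^+ k) <= k.+1)%N.
    move=> p2; elim: k => [|k IH]; first by rewrite expr0 size_polyC oner_eq0.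
    rewrite exprS; apply: leq_trans (size_polyMleq _ _) _.
    by have := leq_add p2 IH; rewrite !add2n; case: (_ + _)%N.
  have h1 : (size ((cos s)%:P - sin s *: 'X)%R <= 2)%N.
    apply: leq_trans (size_polyD _ _) _; rewrite size_polyN geq_max.
    rewrite (leq_trans (size_polyC_leq1 _))//=.
    by rewrite (leq_trans (size_scale_leq _ _))// size_polyX.
  have h2 : (size ((sin s)%:P + cos s *: 'X)%R <= 2)%N.
    apply: leq_trans (size_polyD _ _) _; rewrite geq_max.
    rewrite (leq_trans (size_polyC_leq1 _))//=.
    by rewrite (leq_trans (size_scale_leq _ _))// size_polyX.
  apply: leq_trans (size_polyMleq _ _) _.
  have := leq_add (h _ (n - j)%N h1) (h _ j h2); rewrite addSn addnS subnK// => H.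
  by rewrite -ltnS; move: H; case: (_ + _)%N.
transitivity (binw j * P.[t]).
  by rewrite /P !hornerE /=.
rewrite (horner_coef_wide _ sz) mulr_sumr; apply: eq_bigr => i _.
rewrite !mxE expr1n -/P mulr1; have := binw_gt0 i; move=> /gt_eqF/negbT i0.
by field.
Qed.

Lemma monomials_total (w : 'rV[R]_n.+1) : (forall t, w *m (monomials 1 t)^T = 0) -> w = 0.
Proof.
move=> H; apply: dehom_eq0; apply: poly_zero_fun => t.
by rewrite dehomE elliptic_form_mulmx H mxE.
Qed.

(** The matrix [rotmx s *m (rotmx s)^T] and the identity define the same bilinear form on the
    vectors [monomials 1 t], since a rotation keeps scalar products in the plane. These vectors span
    the space, as only the zero polynomial vanishes everywhere. *)
Lemma rotmx_orth s : rotmx s *m (rotmx s)^T = 1%:M.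
Proof.
apply/eqP; rewrite -subr_eq0; apply/eqP.
set D := _ - _.
have DE t t' : monomials 1 t *m D *m (monomials 1 t')^T = 0.
  have -> : monomials 1 t *m D *m (monomials 1 t')^T =
      (monomials 1 t *m rotmx s) *m (monomials 1 t' *m rotmx s)^T - monomials 1 t *m (monomials 1 t')^T.
    by rewrite /D mulmxBr mulmxBl mulmx1 trmx_mul !mulmxA.
  rewrite -!monomials_rotmx !monomials_dot.
  suff -> : (cos s - sin s * t) * (cos s - sin s * t') + (sin s + cos s * t) * (sin s + cos s * t') =
    1 * 1 + t * t' by rewrite subrr.
  rewrite (_ : _ + _ = (cos s ^+ 2 + sin s ^+ 2) * (1 * 1 + t * t')); last by ring.
  by rewrite cos2Dsin2 mul1r.
have D0 t : monomials 1 t *m D = 0.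
  by apply: monomials_total => t'; exact: DE.
suff DT : D^T = 0 by rewrite -[D]trmxK DT trmx0.
apply/row_matrixP => i; rewrite row0; apply: monomials_total => t.
by rewrite -row_mul -trmx_mul D0 trmx0 row0.
Qed.

Lemma trig_polyD v s theta : cos theta != 0 ->
  trig_poly v (theta + s) = trig_poly (v *m (rotmx s)^T) theta.
Proof.
move=> c0; rewrite /trig_poly.
pose t := tan theta.
have sE : sin theta = cos theta * t by rewrite /t /tan mulrCA divff ?mulr1.
rewrite cosD sinD sE.
have -> : cos theta * cos s - cos theta * t * sin s = cos theta * (cos s - sin s * t) by ring.
have -> : cos theta * t * cos s + cos theta * sin s = cos theta * (sin s + cos s * t) by ring.
rewrite -[X in elliptic_form (v *m _) X]mulr1 !elliptic_formZ; congr (_ * _).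
by rewrite !elliptic_form_mulmx -mulmxA -trmx_mul -monomials_rotmx.
Qed.

Lemma continuous_trig_poly v : continuous (trig_poly v).
Proof.
rewrite /trig_poly /elliptic_form.
have -> : (fun th => \sum_j v 0 j * monomials (cos th) (sin th) 0 j) =
   (fun th : R => \sum_j v 0 j * (binw j * (cos th) ^+ (n - j) * (sin th) ^+ j)).
  by apply/funext => th; apply: eq_bigr => j _; rewrite mxE.
apply: (@continuous_big _ _ +%R 0 xpredT _); first exact: add_continuous.
move=> j _ th; apply: cvgM; first exact: cvg_cst.
apply: cvgM; first (apply: cvgM; first exact: cvg_cst).
  apply: (@continuous_comp _ _ _ cos (fun z : R => z ^+ (n - j)) th).
    exact: continuous_cos.
  exact: exprn_continuous.
apply: (@continuous_comp _ _ _ sin (fun z : R => z ^+ j) th).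
  exact: continuous_sin.
exact: exprn_continuous.
Qed.

Lemma trig_poly0 v : trig_poly v 0 = v 0 ord0.
Proof.
rewrite /trig_poly cos0 sin0 /elliptic_form big_ord_recl big1 ?addr0.
  by rewrite mxE /= expr1n expr0 mulr1 /binw bin0 sqrtr1 !mulr1.
by move=> j _; rewrite mxE expr0n /= !mulr0.
Qed.

Lemma trig_poly_pihalf v : trig_poly v (pi / 2) = v 0 ord_max.
Proof.
rewrite /trig_poly cos_pihalf sin_pihalf /elliptic_form big_ord_recr big1.
  by rewrite mxE /= subnn expr1n expr0 mulr1 /binw binn sqrtr1 !mulr1 add0r.
move=> j _; rewrite mxE expr0n /= subn_eq0 leqNgt ltn_ord /= mulr0 mul0r mulr0.
by [].
Qed.

Lemma measurable_trig_poly d (T : measurableType d) (X : T -> 'rV[R]_n.+1) theta :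
  (forall i, measurable_fun setT (fun w => X w 0 i)) ->
  measurable_fun setT (fun w => trig_poly (X w) theta).
Proof.
move=> mX; apply: measurable_sum => j; apply: measurable_funM => //.
Qed.

End EllipticTrig.

Section CardImage.
Local Open Scope classical_set_scope.

Lemma card_fset_set_image (T U : choiceType) (f : T -> U) (A : set T) :
  {in A &, injective f} -> #|` fset_set (f @` A)| = #|` fset_set A|.
Proof.
move=> inj.
have [fA|iA] := pselect (finite_set A).
  rewrite fset_set_image// card_in_imfset// => x y.
  by rewrite /= !in_fset_set// => xA yA; exact: inj.
have iB : infinite_set (f @` A).
  by move=> fB; apply: iA; rewrite -(eq_finite_set (inj_card_eq inj)).
by rewrite /fset_set; case: pselect => // _; case: pselect.
Qed.

End CardImage.

(** * Zeros of the form on the half circle *)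

Section TrigZeros.
Context {R : realType} (n : nat).
Implicit Types (v : 'rV[R]_n.+1) (al be : R).

Lemma cos_gt0_itv (t : R) : - (pi / 2) < t < pi / 2 -> 0 < cos t.
Proof. by move=> h; apply: cos_gt0_pihalf. Qed.

(** The tangent sends distinct zeros in the open half circle to distinct roots of a polynomial of
    degree at most n. *)
Lemma trig_atleast_eq0 v al be : - (pi / 2) <= al -> be <= pi / 2 ->
  atleast n.+1 (trig_poly v) al be -> v = 0.
Proof.
move=> al0 be0 /atleastP[s sk [ps sb]].
have us : uniq s.
  by move: ps; rewrite lt_path_sortedE => /andP[_]; rewrite lt_sorted_uniq_le => /andP[].
have sI x : x \in s -> - (pi / 2) < x < pi / 2.
  move=> xs; have [xb _] := sb x xs; rewrite (lt_le_trans xb be0) andbT.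
  move: ps; rewrite lt_path_sortedE => /andP[/allP/(_ x xs) + _].
  exact: le_lt_trans.
apply: dehom_eq0; apply/eqP; apply/negPn/negP => d0.
have := @max_poly_roots _ (dehom v) (map tan s) d0.
rewrite size_map sk ltnNge size_dehom => H; suff : false by []; apply: H.
  apply/allP => _ /mapP[x xs ->]; have [_ gx] := sb x xs.
  have c0 := cos_gt0_itv (sI x xs).
  move: gx; rewrite trig_poly_tan ?gt_eqF// => /eqP.
  by rewrite mulf_eq0 expf_eq0 (gt_eqF c0) andbF.
rewrite map_inj_in_uniq// => x y xs ys; apply: tan_inj; rewrite in_itv/=; exact: sI.
Qed.

Lemma trig_finite v al be : - (pi / 2) <= al -> be <= pi / 2 -> v != 0 ->
  finite_set (zeros_in (trig_poly v) al be).
Proof.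
move=> al0 be0 v0; apply: contrapT => /(@atleast_infinite _ n.+1) /(trig_atleast_eq0 al0 be0).
by apply/eqP.
Qed.

Lemma trig_poly_0v theta : trig_poly (0 : 'rV[R]_n.+1) theta = 0.
Proof. by rewrite /trig_poly /elliptic_form big1// => j _; rewrite mxE mul0r. Qed.

Lemma atleast_zero_fun k (g : R -> R) al be : (forall x, g x = 0) -> al < be -> atleast k g al be.
Proof.
move=> g0; elim: k al => // k IH al ab; exists ((al + be) / 2).
  by split => //; rewrite !midf_lt.
by apply: IH; rewrite midf_lt.
Qed.

Lemma trig_infinite0 al be : al < be ->
  infinite_set (zeros_in (trig_poly (0 : 'rV[R]_n.+1)) al be).
Proof.
move=> ab fZ.
have /(atleast_count _ fZ) := atleast_zero_fun
  (zero_count (trig_poly (0 : 'rV[R]_n.+1)) al be).+1 trig_poly_0v ab.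
by rewrite ltnn.
Qed.

Lemma zero_count0 al be : zero_count (trig_poly (0 : 'rV[R]_n.+1)) al be = 0%N.
Proof.
have [ab|ba] := ltP al be; first exact: zero_count_infinite (trig_infinite0 ab).
rewrite /zero_count (_ : zeros_in _ _ _ = set0) ?fset_set0 ?cardfs0//.
apply/seteqP; split => x // -[/andP[h1 h2] _].
by have := lt_trans h1 h2; rewrite ltNge ba.
Qed.

Lemma zero_count_le v al be : - (pi / 2) <= al -> be <= pi / 2 ->
  (zero_count (trig_poly v) al be <= n)%N.
Proof.
move=> al0 be0; have [->|v0] := eqVneq v 0; first by rewrite zero_count0.
rewrite leqNgt; apply/negP => /(atleast_count _ (trig_finite al0 be0 v0)).
by move=> /(trig_atleast_eq0 al0 be0)/eqP; rewrite (negbTE v0).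
Qed.

Lemma trig_shift_count v s al be : al < be ->
  - (pi / 2) <= al -> be <= pi / 2 ->
  zero_count (trig_poly v) (al + s) (be + s) =
  zero_count (trig_poly (v *m (rotmx n s)^T)) al be.
Proof.
move=> ab al0 be0; rewrite /zero_count.
rewrite -[RHS](@card_fset_set_image _ _ (fun x => x + s)); last first.
  by move=> x y _ _; exact: addIr.
congr (size (enum_fset (fset_set _))); apply/seteqP; split => x /=.
  move=> [/andP[h1 h2] gx]; exists (x - s); last by rewrite subrK.
  have h : al < x - s < be by rewrite ltrBrDr ltrBlDr h1 h2.
  have c0 : cos (x - s) != 0.
    rewrite gt_eqF//; apply: cos_gt0_itv; case/andP: h => h3 h4.
    by rewrite (le_lt_trans al0 h3) (lt_le_trans h4 be0).
  by split => //; rewrite -trig_polyD// subrK.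
move=> [y [/andP[h1 h2] gy] <-]; rewrite /zeros_in/= !ltrD2r h1 h2; split => //.
rewrite trig_polyD// gt_eqF//; apply: cos_gt0_itv.
by rewrite (le_lt_trans al0 h1) (lt_le_trans h2 be0).
Qed.

Definition atanE (a : \bar R) : R :=
  match a with r%:E => atan r | +oo%E => pi / 2 | -oo%E => - (pi / 2) end.

Lemma atanE_ge a : - (pi / 2) <= atanE a.
Proof.
case: a => [r||] //=; first by rewrite ltW// atan_gtNpi2.
by have := @pi_ge0 R; lra.
Qed.

Lemma atanE_le a : atanE a <= pi / 2.
Proof.
case: a => [r||] //=; first by rewrite ltW// atan_ltpi2.
by have := @pi_ge0 R; lra.
Qed.

Lemma atanE_lt a b : (a < b)%E -> atanE a < atanE b.
Proof.
case: a b => [r||] [s||] //=.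
- by rewrite lte_fin; exact: lt_atan.
- by rewrite atan_ltpi2.
- by rewrite atan_gtNpi2.
- by have := @pi_gt0 R; lra.
Qed.

(** Substitution x = tan theta: it is an increasing bijection from the open half circle to the line,
    and there the form equals the polynomial at tan theta times a positive power of cos theta. *)
Lemma num_real_zerosE (d : measure_display) (T : measurableType d) (P : probability T R)
    (omega : nat -> {RV P >-> R}) (a b : \bar R) w :
  num_real_zeros omega n a b w =
  (zero_count (trig_poly (\row_(j < n.+1) omega j w)) (atanE a) (atanE b))%:R.
Proof.
set v := \row_(j < n.+1) omega j w.
have pE : elliptic_poly omega n w = dehom v.
  apply/polyP => j; rewrite !coef_poly; case: ifP => // jn.
  by rewrite mxE inordK.
rewrite /num_real_zeros pE; congr (_%:R).
rewrite /zero_count -[RHS](@card_fset_set_image _ _ tan); last first.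
  move=> x y /[!inE] -[/andP[x1 x2] _] [/andP[y1 y2] _]; apply: tan_inj; rewrite in_itv/=.
    by rewrite (le_lt_trans (atanE_ge a) x1) (lt_le_trans x2 (atanE_le b)).
  by rewrite (le_lt_trans (atanE_ge a) y1) (lt_le_trans y2 (atanE_le b)).
have ltaE (x : R) : ((a < x%:E)%E <-> atanE a < atan x) /\ ((x%:E < b)%E <-> atan x < atanE b).
  split; split; try exact: (@atanE_lt _ x%:E); try exact: (@atanE_lt x%:E).
    by apply: contraTT; rewrite -!leNgt le_eqVlt => /orP[/eqP<-//|/atanE_lt/ltW].
  by apply: contraTT; rewrite -!leNgt le_eqVlt => /orP[/eqP->//|/atanE_lt/ltW].
congr (size (enum_fset (fset_set _))); apply/seteqP; split => x /=.
  move=> [/andP[ax xb] rx]; exists (atan x); last exact: atanK.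
  have ax' := (ltaE x).1.1 ax; have xb' := (ltaE x).2.1 xb.
  split; first by rewrite ax' xb'.
  have ca : cos (atan x) != 0.
    by rewrite gt_eqF// cos_gt0_itv// atan_gtNpi2 atan_ltpi2.
  by rewrite trig_poly_tan// atanK (eqP rx) mulr0.
move=> [t [/andP[h1 h2] gt0] <-].
have tI : - (pi / 2) < t < pi / 2.
  by rewrite (le_lt_trans (atanE_ge a) h1) (lt_le_trans h2 (atanE_le b)).
have tK : atan (tan t) = t by rewrite tanK// in_itv.
split; first by apply/andP; split; [apply/(ltaE _).1|apply/(ltaE _).2]; rewrite tK.
have c0 := cos_gt0_itv tI.
move: gt0; rewrite trig_poly_tan ?gt_eqF// => /eqP.
by rewrite mulf_eq0 expf_eq0 (gt_eqF c0) andbF.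
Qed.

End TrigZeros.

(** * Stationarity and short arcs *)

Section BoundedMeans.
Context d (T : measurableType d) (R : realType) (P : probability T R).
Implicit Types X Y : T -> R.

(** Bounded measurable functions, whose expectations are finite, so that [mean] is additive and
    monotone on them. *)
Definition bmf X := measurable_fun setT X /\ exists M, forall w, `|X w| <= M.

Lemma bmf_integrable X : bmf X -> P.-integrable setT (EFin \o X).
Proof.
move=> [mX [M HM]]; have fP : (P setT < +oo)%E by rewrite probability_setT ltry.
apply: (measurable_bounded_integrable measurableT fP mX).
exists M; split; first exact: num_real.
by move=> y My w _; apply: le_trans (HM w) (ltW My).
Qed.

Lemma bmfD X Y : bmf X -> bmf Y -> bmf (fun w => X w + Y w).
Proof.
move=> [mX [M HM]] [mY [M' HM']]; split; first exact: measurable_funD.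
by exists (M + M') => w; apply: le_trans (ler_normD _ _) (lerD (HM w) (HM' w)).
Qed.

Lemma meanD X Y : bmf X -> bmf Y -> mean P (fun w => X w + Y w) = mean P X + mean P Y.
Proof.
move=> bX bY; have iX := bmf_integrable bX; have iY := bmf_integrable bY.
rewrite /mean unlock -fineD; try exact: integrable_fin_num.
by rewrite -integralD.
Qed.

Lemma mean_le X Y : bmf X -> bmf Y -> (forall w, X w <= Y w) -> mean P X <= mean P Y.
Proof.
move=> bX bY XY; have iX := bmf_integrable bX; have iY := bmf_integrable bY.
rewrite /mean unlock; apply: fine_le; try exact: integrable_fin_num.
by apply: le_integral => // w _; rewrite lee_fin.
Qed.

Lemma bmf_indic (A : set T) : measurable A -> bmf (\1_A : T -> R).
Proof.
move=> mA; split; first exact: measurable_indic.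
by exists 1 => w; rewrite indicE; case: (_ \in _); rewrite ?normr1 ?normr0.
Qed.

Lemma mean_indic (A : set T) : measurable A -> mean P (\1_A : T -> R) = fine (P A).
Proof. by move=> mA; rewrite /mean expectation_indic. Qed.

Lemma bmf_count (X : T -> nat) (n : nat) (h : nat -> R) :
  (forall k, measurable [set w | X w = k]) -> (forall w, (X w <= n)%N) ->
  bmf (fun w => h (X w)).
Proof.
move=> mX Xn; split; last first.
  exists (\sum_(j < n.+1) `|h j|) => w.
  rewrite (bigD1 (Ordinal (Xn w : (X w < n.+1)%N)))//= lerDl sumr_ge0//.
have -> : (fun w => h (X w)) = (fun w => \sum_(j < n.+1) h j * \1_[set w | X w = j] w).
  apply/funext => w; rewrite (bigD1 (Ordinal (Xn w : X w < n.+1)%N))//= big1 ?addr0.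
    by rewrite indicE mem_set// mulr1.
  move=> j jX; rewrite indicE memNset ?mulr0//= => XE.
  by move/eqP: jX; apply; apply/val_inj.
by apply: measurable_sum => j; apply: measurable_funM.
Qed.

End BoundedMeans.

Section Stationarity.
Context d (T : measurableType d) (R : realType) (P : probability T R) (n : nat).
Variable V : T -> 'rV[R]_n.+1.
Hypothesis gV : giid P V.
Local Notation RT := (measurableTypeR R).
Local Notation gamma := (normal_prob (0 : R) 1).

Definition zero_num (al be : R) (w : T) : nat := zero_count (trig_poly (V w)) al be.

Definition angles (al be : R) := [&& - (pi / 2) <= al, al < be & be <= pi / 2].

Let measurable_zero_count_trig d' (T' : measurableType d') (X : T' -> 'rV[R]_n.+1) al be :
  angles al be -> (forall i, measurable_fun setT (fun w => X w 0 i)) -> forall k,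
  measurable [set w | zero_count (trig_poly (X w)) al be = k].
Proof.
move=> /and3P[a1 a2 a3] mX; apply: (@measurable_zero_count R _ _ _ _ _ n.+1).
- by move=> w; exact: continuous_trig_poly.
- by move=> x; exact: measurable_trig_poly.
- by move=> w /(trig_atleast_eq0 a1 a3) ->; exact: trig_infinite0.
Qed.

Lemma measurable_zero_num al be : angles al be -> forall k,
  measurable [set w | zero_num al be w = k].
Proof. by move=> ab; apply: measurable_zero_count_trig => //; have [] := gV. Qed.

Lemma zero_num_le al be w : angles al be -> (zero_num al be w <= n)%N.
Proof. by move=> /and3P[a1 a2 a3]; exact: zero_count_le. Qed.

Lemma bmf_zero_num al be h : angles al be -> bmf (fun w => h (zero_num al be w) : R).
Proof.
move=> ab; apply: (@bmf_count _ _ _ _ n); first exact: measurable_zero_num.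
by move=> w; exact: zero_num_le.
Qed.

Definition untuple (t : n.+1.-tuple RT) : 'rV[R]_n.+1 := \row_i tnth t i.

Lemma rowtupleK v : untuple (rowtuple v) = v.
Proof. by apply/rowP => i; rewrite mxE tnth_mktuple. Qed.

Let gVrot s : giid P (fun w => V w *m (rotmx n s)^T).
Proof.
apply: preserves_giid_orthogonal => //.
rewrite trmxK; exact: mulmx1C (rotmx_orth n s).
Qed.

(** Shifting the arc by s amounts to replacing V by V *m (rotmx s)^T, which has the same law because
    the matrix is orthogonal. *)
Lemma zero_num_shift s al be : angles al be -> angles (al + s) (be + s) -> forall k,
  P [set w | zero_num (al + s) (be + s) w = k] = P [set w | zero_num al be w = k].
Proof.
move=> ab abs k.
pose C := [set t : n.+1.-tuple RT | zero_count (trig_poly (untuple t)) al be = k].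
have mC : measurable C.
  apply: measurable_zero_count_trig => // i.
  have := @measurable_tnth _ RT n.+1 i; congr measurable_fun.
  by apply/funext => t; rewrite mxE.
have := giid_law_unique (gVrot s) gV mC.
rewrite (_ : [set w | C (rowtuple (V w))] = [set w | zero_num al be w = k]); last first.
  by apply/seteqP; split => w; rewrite /C /= rowtupleK.
move=> <-; congr (P _); have /and3P[a1 a2 a3] := ab.
by apply/seteqP; split => w; rewrite /C /= rowtupleK /zero_num trig_shift_count.
Qed.

Lemma mean_zero_num_shift s al be (h : nat -> R) : angles al be -> angles (al + s) (be + s) ->
  mean P (fun w => h (zero_num (al + s) (be + s) w)) = mean P (fun w => h (zero_num al be w)).
Proof.
move=> ab abs; rewrite /mean.
rewrite (expectation_finite P (measurable_zero_num abs) (fun w => zero_num_le w abs)).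
rewrite (expectation_finite P (measurable_zero_num ab) (fun w => zero_num_le w ab)) /=.
by apply: eq_bigr => j _; rewrite /pmass zero_num_shift.
Qed.

Lemma giid_coord (X : T -> 'rV[R]_n.+1) (i : 'I_n.+1) (A : set RT) :
  giid P X -> measurable A -> P [set w | A (X w 0 i)] = gamma A.
Proof.
move=> [_ _ gX] mA; have := gX (fun j => if j == i then A else setT) _.
rewrite (bigD1 i)//= eqxx big1 ?mule1; last first.
  move=> j /negbTE ->; exact: (@probability_setT _ _ _ (normal_prob (0 : R) 1)).
rewrite probability_setT mul1e => <-; last by move=> j; case: ifP.
congr (P _); apply/seteqP; split => w /=.
  by move=> Aw j; case: eqP => // ->.
by move=> /(_ i); rewrite eqxx.
Qed.

Lemma gamma_set1 x : gamma [set x] = 0%E.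
Proof.
have /null_content_dominatesP := @normal_prob_dominates R 0 1.
by apply; [exact: measurable_set1|exact: lebesgue_measure_set1].
Qed.

(** By rotation the value at th has the law of the value at 0, which is the first coefficient, and
    the normal law has no atom. *)
Lemma trig_zero_null th : P [set w | trig_poly (V w) th = 0] = 0%E.
Proof.
have c0 : cos (0 : R) != 0 by rewrite cos0 oner_eq0.
rewrite -(gamma_set1 0) -(giid_coord ord0 (gVrot th)) //.
congr (P _); apply/seteqP; split => w /=.
  by rewrite -[th in X in X -> _]add0r trig_polyD// trig_poly0.
by rewrite -[th in X in _ -> X]add0r trig_polyD// trig_poly0.
Qed.

End Stationarity.

(** * Cutting an arc in two *)

Section Splitting.
Context {R : realType}.
Implicit Types (g : R -> R) (a b c : R).

Lemma atleast_cat k l g a b c : a <= b -> b <= c ->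
  atleast k g a b -> atleast l g b c -> atleast (k + l) g a c.
Proof.
elim: k a => [|k IH] a ab bc; first by move=> _; exact: atleast_mono.
move=> [x [/andP[ax xb] gx] H] Hl; exists x; last exact: IH (ltW xb) bc H Hl.
by split => //; rewrite ax (lt_le_trans xb bc).
Qed.

Lemma atleast_split k g a b c : atleast k g a c -> exists i j,
  [/\ (k <= i + j + (g b == 0%R))%N, atleast i g a b & atleast j g b c].
Proof.
elim: k a => [|k IH] a; first by exists 0%N, 0%N; split.
move=> [x [/andP[ax xc] gx] H]; have [xb|bx|xb] := ltgtP x b.
- have [i [j [kij Hi Hj]]] := IH _ H; exists i.+1, j; split => //.
  by exists x => //; rewrite /zeros_in/= ax xb.
- exists 0%N, k.+1; split => //; first by rewrite add0n leq_addr.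
  by exists x => //; rewrite /zeros_in/= bx xc.
- exists 0%N, k; split => //; last by rewrite -xb.
  by rewrite -xb gx eqxx add0n addn1.
Qed.

Lemma trig_count_super n (v : 'rV[R]_n.+1) a b c : angles a b -> angles b c ->
  (zero_count (trig_poly v) a b + zero_count (trig_poly v) b c <= zero_count (trig_poly v) a c)%N.
Proof.
move=> /and3P[a1 ab b2] /and3P[b1 bc c2].
have [->|v0] := eqVneq v 0; first by rewrite !zero_count0.
apply/(atleast_count _ (trig_finite a1 c2 v0)).
by apply: (@atleast_cat _ _ _ _ b); rewrite ?ltW//; apply/atleast_count => //; exact: trig_finite.
Qed.

Lemma trig_count_sub n (v : 'rV[R]_n.+1) a b c : angles a b -> angles b c ->
  (zero_count (trig_poly v) a c <=
   zero_count (trig_poly v) a b + zero_count (trig_poly v) b c + (trig_poly v b == 0%R))%N.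
Proof.
move=> /and3P[a1 ab b2] /and3P[b1 bc c2].
have [->|v0] := eqVneq v 0; first by rewrite !zero_count0.
have /(atleast_split b)[i [j [kij Hi Hj]]] : atleast (zero_count (trig_poly v) a c) (trig_poly v) a c.
  by apply/atleast_count => //; exact: trig_finite.
apply: leq_trans kij _; rewrite leq_add2r; apply: leq_add.
  by apply/(atleast_count _ (trig_finite a1 b2 v0)).
by apply/(atleast_count _ (trig_finite b1 c2 v0)).
Qed.

End Splitting.

Section SmallIntervals.
Context d (T : measurableType d) (R : realType) (P : probability T R) (n : nat).
Variable V : T -> 'rV[R]_n.+1.
Hypothesis gV : giid P V.
Local Notation RT := (measurableTypeR R).
Local Notation gamma := (normal_prob (0 : R) 1).

Let N := zero_num V.
Let E al be := mean P (fun w => (N al be w)%:R).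
Let F al be := mean P (fun w => (N al be w)%:R ^+ 5).

Let bE al be : angles al be -> bmf (fun w => (N al be w)%:R : R).
Proof. exact: (bmf_zero_num gV (fun j => j%:R)). Qed.

Let bF al be : angles al be -> bmf (fun w => (N al be w)%:R ^+ 5 : R).
Proof. exact: (bmf_zero_num gV (fun j => j%:R ^+ 5)). Qed.

Let measurable_trig_zero th : measurable [set w | trig_poly (V w) th = 0].
Proof.
have [_ mV _] := gV.
have := measurable_trig_poly th mV measurableT (measurable_set1 0).
by rewrite setTI.
Qed.

(** Pathwise the count is additive unless the cutting point is itself a zero, which is a null
    event. *)
Lemma mean_zero_num_add al be ga : angles al be -> angles be ga -> E al ga = E al be + E be ga.
Proof.
move=> ab bc; have ac : angles al ga.
  by case/and3P: ab => a1 a2 a3; case/and3P: bc => b1 b2 b3; apply/and3P; split => //; apply: lt_trans b2.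
apply/eqP; rewrite eq_le; apply/andP; split; last first.
  rewrite -(meanD _ (bE ab) (bE bc)); apply: mean_le; [exact: bmfD (bE ab) (bE bc)|exact: bE|].
  by move=> w; rewrite -natrD ler_nat; exact: trig_count_super.
have bI := bmf_indic R (measurable_trig_zero be).
have bS := bmfD (bE ab) (bE bc).
have -> : E al be + E be ga =
    mean P (fun w => (N al be w)%:R + (N be ga w)%:R + \1_[set w | trig_poly (V w) be = 0] w).
  by rewrite (meanD _ bS bI) mean_indic// trig_zero_null// addr0 (meanD _ (bE ab) (bE bc)).
apply: mean_le; [exact: bE|exact: bmfD bS bI|] => w.
have := trig_count_sub (V w) ab bc; rewrite -(ler_nat R) !natrD => /le_trans; apply.
rewrite lerD2l indicE; case: eqP => h; first by rewrite mem_set.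
by rewrite ler0n.
Qed.

Lemma mean_pow_super al be ga : angles al be -> angles be ga -> F al be + F be ga <= F al ga.
Proof.
move=> ab bc; have ac : angles al ga.
  by case/and3P: ab => a1 a2 a3; case/and3P: bc => b1 b2 b3; apply/and3P; split => //; apply: lt_trans b2.
rewrite -(meanD _ (bF ab) (bF bc)); apply: mean_le; [exact: bmfD (bF ab) (bF bc)|exact: bF|].
move=> w; apply: (@le_trans _ _ (((N al be w)%:R + (N be ga w)%:R) ^+ 5)).
  have x0 : 0 <= (N al be w)%:R :> R by [].
  have y0 : 0 <= (N be ga w)%:R :> R by [].
  move: x0 y0; set x := _%:R; set y := _%:R => x0 y0.
  rewrite (_ : (x + y) ^+ 5 = x ^+ 5 + y ^+ 5 +
    (5 * x ^+ 4 * y + 10 * x ^+ 3 * y ^+ 2 + 10 * x ^+ 2 * y ^+ 3 + 5 * x * y ^+ 4)); last by ring.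
  by rewrite lerDl !addr_ge0// !mulr_ge0// exprn_ge0.
rewrite -natrD lerXn2r ?nnegrE ?ler0n//.
by rewrite ler_nat; exact: trig_count_super.
Qed.

Lemma mean_zero_num_ge0 al be : 0 <= E al be.
Proof. by rewrite /E /mean unlock fine_ge0// integral_ge0// => w _; rewrite lee_fin. Qed.

Lemma mean_pow_ge0 al be : 0 <= F al be.
Proof.
by rewrite /F /mean unlock fine_ge0// integral_ge0// => w _; rewrite lee_fin exprn_ge0.
Qed.

Let p := (pi : R) / 2.

Lemma gamma_neg : gamma `]-oo, 0%R[ = gamma `]0%R, +oo[.
Proof.
have mp : measurable (`]0%R, +oo[%classic : set RT) by exact: measurable_itv.
rewrite -(normal_probN mp); congr (normal_prob _ _).
by apply/seteqP; split => x /=; rewrite !in_itv/= ?andbT oppr_gt0.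
Qed.

Lemma normal_prob_gt0 : (2^-1%:E <= gamma `]0%R, +oo[)%E.
Proof.
have mp : measurable (`]0%R, +oo[%classic : set RT) by exact: measurable_itv.
have mn : measurable (`]-oo, 0%R[%classic : set RT) by exact: measurable_itv.
have U : [set: RT] = (`]0%R, +oo[ `|` [set 0%R]) `|` `]-oo, 0%R[.
  apply/seteqP; split => x // _ /=; rewrite !in_itv/= andbT.
  by have [h|h|h] := ltgtP 0 x; [left; left|right|left; right].
have := @probability_setT _ _ _ (normal_prob (0 : R) 1).
move=> H.
have h1 : (gamma setT <= gamma (`]0%R, +oo[ `|` [set 0%R]) + gamma `]-oo, 0%R[)%E.
  rewrite U; exact: @measureU2 _ _ _ (normal_prob (0 : R) 1) _ _ (measurableU _ _ mp (measurable_set1 0)) mn.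
have h2 : (gamma (`]0%R, +oo[ `|` [set 0%R]) <= gamma `]0%R, +oo[ + gamma [set 0%R])%E.
  exact: @measureU2 _ _ _ (normal_prob (0 : R) 1) _ _ mp (measurable_set1 0).
rewrite gamma_set1 adde0 in h2.
rewrite H gamma_neg in h1.
have := le_trans h1 (leeD2r _ h2).
have fg : gamma `]0%R, +oo[ \is a fin_num by exact: fin_num_measure.
rewrite -(fineK fg) -EFinD !lee_fin; lra.
Qed.

(** A crude bound suffices. The form takes the first coefficient as its value at angle 0 and the
    last one at pi/2; these are distinct for n >= 1, and with probability at least 1/4 the first is
    negative and the last positive, which forces a zero in between. *)
Lemma mean_all_zeros : (1 <= n)%N -> 4^-1 <= E (- p) p.
Proof.
move=> n1; have pi0 := @pi_gt0 R.
have ang : angles (- p) p by apply/and3P; split => //; rewrite /p; lra.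
pose A := [set w | V w 0 ord0 < 0 /\ 0 < V w 0 ord_max].
have [_ mV hV] := gV.
have PA : P A = (gamma `]0%R, +oo[ * gamma `]0%R, +oo[)%E.
  have n0 : (ord_max == ord0 :> 'I_n.+1) = false by apply/negP => /eqP/(congr1 val)/= h; rewrite h in n1.
  pose B (j : 'I_n.+1) : set RT :=
    if j == ord0 then `]-oo, 0%R[%classic else if j == ord_max then `]0%R, +oo[%classic else setT.
  have mB j : measurable (B j).
    by rewrite /B; case: ifP => _; [exact: measurable_itv|case: ifP => _ //; exact: measurable_itv].
  have := hV B mB; rewrite (bigD1 ord0)//= (bigD1 ord_max) ?n0//= big1 ?mule1; last first.
    move=> j /andP[/negbTE j0 /negbTE jm]; rewrite /B j0 jm.
    exact: (@probability_setT _ _ _ (normal_prob (0 : R) 1)).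
  rewrite /B eqxx n0 eqxx gamma_neg probability_setT mul1e => <-.
  congr (P _); apply/seteqP; split => w /=.
    move=> [h0 hm] j; case: eqP => [->|_]; first by rewrite /= in_itv.
    by case: eqP => [->|//]; rewrite /= in_itv/= hm.
  move=> h; have := h ord0; have := h ord_max.
  by rewrite n0 eqxx /= !in_itv/= andbT => ? ?; split.
have mA : measurable A.
  rewrite (_ : A = [set w | V w 0 ord0 < 0] `&` [set w | 0 < V w 0 ord_max])//.
  apply: measurableI.
    have := mV ord0 measurableT _ (measurable_itv `]-oo, 0[).
    by rewrite setTI; congr measurable; apply/seteqP; split => w /=; rewrite in_itv.
  have := mV ord_max measurableT _ (measurable_itv `]0, +oo[).
  by rewrite setTI; congr measurable; apply/seteqP; split => w /=; rewrite in_itv/= andbT.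
apply: (@le_trans _ _ (fine (P A))).
  rewrite PA; have fg : gamma `]0%R, +oo[ \is a fin_num by exact: fin_num_measure.
  have := normal_prob_gt0; rewrite -(fineK fg) -EFinM lee_fin /=; nra.
rewrite -mean_indic//; apply: mean_le; [exact: bmf_indic|exact: bE|] => w.
rewrite indicE; have [/set_mem[h0 hm]|] := boolP (w \in A); last by rewrite ler0n.
rewrite /= ler1n.
have v0 : V w != 0 by apply/eqP => v0; move: h0; rewrite v0 mxE ltxx.
have /and3P[a1 a2 a3] := ang.
apply/(atleast_count 1 (trig_finite a1 a3 v0)).
have p0 : 0 < p by rewrite /p; lra.
have [x] : exists2 c, c \in `[0, p] & trig_poly (V w) c = 0.
  apply: IVT; first exact: ltW.
    apply: continuous_subspaceT => x; exact: continuous_trig_poly.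
  rewrite trig_poly0 trig_poly_pihalf; apply/andP; split.
    by rewrite ge_min ltW.
  by rewrite le_max (ltW hm) orbT.
rewrite in_itv/= => /andP[x0 xp] fx; exists x => //; split => //.
apply/andP; split; first by apply: lt_le_trans x0; rewrite oppr_lt0.
rewrite lt_neqAle xp andbT; apply/eqP => xE.
by move: fx; rewrite xE trig_poly_pihalf => fx; move: hm; rewrite fx ltxx.
Qed.

(** Here j+1 rotated copies of the arc are laid end to end from -pi/2; the length condition says
    that they fit into the half circle. *)
Lemma mean_dilate al be j : angles al be -> j.+1%:R * (be - al) <= pi ->
  let th := - p + j.+1%:R * (be - al) in
  [/\ angles (- p) th, E (- p) th = j.+1%:R * E al be & j.+1%:R * F al be <= F (- p) th].
Proof.
move=> ab; have /and3P[a1 a2 a3] := ab; have pi0 := @pi_gt0 R.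
have d0 : 0 < be - al by lra.
have shift s : - p <= al + s -> be + s <= p ->
    [/\ angles (al + s) (be + s), E (al + s) (be + s) = E al be & F (al + s) (be + s) = F al be].
  move=> s1 s2; have abs : angles (al + s) (be + s) by apply/and3P; split => //; lra.
  split => //; first exact: (mean_zero_num_shift gV (fun j => j%:R) ab abs).
  exact: (mean_zero_num_shift gV (fun j => j%:R ^+ 5) ab abs).
elim: j => [|j IH] jpi th.
  have [] := shift (- p - al); rewrite /p in jpi *; try lra.
  rewrite (_ : al + _ = - p); last by rewrite /p; lra.
  rewrite (_ : be + _ = th); last by rewrite /th /p; lra.
  by move=> h1 h2 h3; split; rewrite ?mul1r// -h3.
have jpi' : j.+1%:R * (be - al) <= pi.
  by apply: le_trans jpi; rewrite ler_pM2r// ler_nat.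
have [h1 h2 h3] := IH jpi'; move: h1 h2 h3; set th' := - p + _ => h1 h2 h3.
have thE : th = th' + (be - al) by rewrite /th /th' -[j.+2%:R]natr1; ring.
have thp : th <= p by rewrite /th /p; lra.
have [] := shift (th' - al).
- by rewrite addrC subrK; have /and3P[_ /ltW] := h1.
- by rewrite (_ : be + _ = th)// thE; ring.
rewrite (_ : al + _ = th'); last by ring.
rewrite (_ : be + _ = th); last by rewrite thE; ring.
move=> k1 k2 k3; split.
- by case/and3P: h1 => x1 x2 x3; case/and3P: k1 => y1 y2 y3; apply/and3P; split => //; lra.
- by rewrite (mean_zero_num_add h1 k1) h2 k2 -[j.+2%:R]natr1; ring.
- apply: le_trans (mean_pow_super h1 k1); rewrite k3 -[j.+2%:R]natr1 mulrDl mul1r.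
  by rewrite lerD2r.
Qed.

(* Rotated copies of a short arc tile an arc with mean of order one, on which the
   fifth moment is under control; superadditivity of the fifth power then bounds
   the fifth moment on the short arc by its mean. *)
Lemma mean_pow_small al be : (1 <= n)%N -> angles al be -> 0 < E al be <= 1 ->
  exists th, [/\ angles (- p) th, E (- p) th <= 1 & F al be <= 8 * E al be * F (- p) th].
Proof.
move=> n1 ab /andP[e0 e1]; have /and3P[a1 a2 a3] := ab; have pi0 := @pi_gt0 R.
have d0 : 0 < be - al by lra.
(* [Q j] says that j+1 copies fit into the half circle and have total mean at most 1. The second
   condition bounds j by 1/E, so a largest such j exists. *)
pose Q (j : nat) := (j.+1%:R * (be - al) <= pi) && (j.+1%:R * E al be <= 1).
have Q0 : exists j, Q j.
  by exists 0%N; rewrite /Q !mul1r e1 andbT /p in a1 a3 *; lra.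
have Qub j : Q j -> (j <= Num.truncn (E al be)^-1)%N.
  move=> /andP[_ h]; rewrite truncn_ge_nat ?invr_ge0 ?ltW//.
  rewrite -(ltr_pM2r e0) mulVf ?gt_eqF//; apply: lt_le_trans h.
  by rewrite ltr_pM2r// ltr_nat.
have [j /andP[j1 j2] jmax] := ex_maxnP Q0 Qub.
have [h1 h2 h3] := mean_dilate ab j1.
move: h1 h2 h3; set th := - p + _ => h1 h2 h3.
exists th; split => //; first by rewrite h2.
(* Maximality has two causes. If the mean of j+2 copies exceeds 1, then that of j+1 copies is at
   least 1/2. If j+2 copies do not fit, the uncovered part of the half circle is shorter than one
   copy, so its mean is at most E; then (j+1) E + E >= 1/4, whence (j+1) E >= 1/8. *)
have key : 8^-1 <= j.+1%:R * E al be.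
  have : ~~ Q j.+1 by apply/negP => /jmax; rewrite ltnn.
  have j1' : 1 <= j.+1%:R :> R by rewrite ler1n.
  rewrite negb_and -!ltNge -!(natr1 j.+1) => /orP[h|h]; last by nra.
  have big := mean_all_zeros n1.
  have thp : th <= p by have /and3P[] := h1.
  have thE : th + p = j.+1%:R * (be - al) by rewrite /th; ring.
  have [E1|th_lt] := eqVneq th p; first by rewrite -h2 E1; lra.
  have thp' : th < p by rewrite lt_neqAle th_lt.
  have ang2 : angles th p by have /and3P[x1 x2 x3] := h1; apply/and3P; split => //; lra.
  (* The uncovered arc, rotated so as to start at al, is contained in the original arc. *)
  have ang3 : angles (th + (al - th)) (p + (al - th)).
    apply/and3P; split; [lra|lra|].
    by rewrite -/p; move: h; rewrite mulrDl mul1r -thE /p; lra.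
  have ang4 : angles (p + (al - th)) be.
    apply/and3P; split; [|by move: h; rewrite mulrDl mul1r -thE /p; lra|lra].
    by have /and3P[x1 x2 x3] := ang3; rewrite ltW// (le_lt_trans x1).
  have := mean_zero_num_shift gV (fun j => j%:R) ang2 ang3.
  rewrite -/(E th p) -/(E (th + (al - th)) (p + (al - th))) => shE.
  move: big; rewrite (mean_zero_num_add h1 ang2) h2 -shE.
  have := mean_zero_num_add ang3 ang4; rewrite subrKC.
  by have := mean_zero_num_ge0 (p + (al - th)) be; nra.
have FJ := mean_pow_ge0 (- p) th.
have F0 := mean_pow_ge0 al be.
have j0 : 0 < j.+1%:R :> R by rewrite ltr0n.
have k1 : F al be <= 8 * (j.+1%:R * E al be) * F al be.
  by rewrite -[leLHS]mul1r; apply: ler_wpM2r => //; lra.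
apply: le_trans k1 _; rewrite (_ : _ * F al be = 8 * E al be * (j.+1%:R * F al be)); last by ring.
by apply: ler_wpM2l => //; rewrite mulr_ge0// ltW.
Qed.

End SmallIntervals.

(** * The theorem *)

Section Assembly.
Context (R : realType) (d : measure_display) (T : measurableType d) (P : probability T R).
Variable omega : nat -> {RV P >-> R}.
Local Notation RT := (measurableTypeR R).

Definition coeffs (n : nat) (w : T) : 'rV[R]_n.+1 := \row_(j < n.+1) omega j w.

Lemma giid_coeffs n : iid_std_gaussian omega -> giid P (coeffs n).
Proof.
move=> [ind gau]; split.
- by rewrite probability_setT ltry.
- move=> i; have := @measurable_funPT _ _ _ _ (omega i); congr measurable_fun.
  by apply/funext => w; rewrite mxE.
move=> A mA.
have mA' j : j \in iota 0 n.+1 -> measurable (A (inord j)) by [].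
have := ind (iota 0 n.+1) (fun j => A (inord j)) (iota_uniq _ _) mA'.
have memE j : [set` iota 0 n.+1] j <-> (j < n.+1)%N.
  by rewrite -[(j < _)%N]/((0 <= j < 0 + n.+1)%N) -mem_iota.
rewrite (_ : \bigcap_(j in _) _ = [set w | forall i, A i (coeffs n w 0 i)]); last first.
  apply/seteqP; split => w /= h.
    move=> i; have := h i; rewrite /preimage /mkset inord_val mxE; apply.
    by apply/memE; exact: ltn_ord.
  move=> j /memE jn; have := h (inord j).
  by rewrite mxE inordK.
move=> ->; rewrite probability_setT mul1e.
rewrite -[X in iota 0 X](subn0 n.+1) -/(index_iota 0 n.+1) big_mkord.
apply: eq_bigr => i _; rewrite inord_val.
exact: (gau i (A i) (mA i)).
Qed.

Hypothesis homega : iid_std_gaussian omega.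
Variables (n : nat) (a b : \bar R).
Hypothesis ab : (a < b)%E.

Let X := zero_num (coeffs n) (atanE a) (atanE b).
Let Y := num_real_zeros omega n a b.

Let ang : angles (atanE a) (atanE b).
Proof. by rewrite /angles atanE_ge atanE_le atanE_lt. Qed.

Let mX := measurable_zero_num (giid_coeffs n homega) ang.
Let Xn w : (X w <= n)%N := zero_num_le (coeffs n) w ang.

Lemma num_real_zeros_fun : Y = (fun w => (X w)%:R).
Proof. by apply/funext => w; exact: num_real_zerosE. Qed.

Definition raw_moment (k : nat) (Z : T -> R) : R := mean P (fun w => Z w ^+ k).

Let q := @pmass _ _ _ P X n.

Lemma central_momentE k : central_moment P k Y = moment_about q (mean P Y) k.
Proof.
by rewrite /central_moment num_real_zeros_fun (mean_moment_finite P mX Xn).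
Qed.

Lemma raw_momentE k : raw_moment k Y = moment_about q 0 k.
Proof.
rewrite -(mean_moment_finite P mX Xn) /raw_moment num_real_zeros_fun.
by congr (mean P _); apply/funext => w; rewrite subr0.
Qed.

Lemma raw_moment_rec j : raw_moment j.+1 Y =
  \sum_(i < j.+1) 'C(j, i)%:R * cumulant P i.+1 Y * raw_moment (j - i)%N Y.
Proof.
rewrite raw_momentE (moment_cumulant_rec 0 j (@pmass_ge0 _ _ _ P X n) (pmass_sum P mX Xn) (cumulant_finite P mX Xn)).
by apply: eq_bigr => i _; rewrite mul0rn subr0 raw_momentE num_real_zeros_fun.
Qed.

Lemma raw_moment0 : raw_moment 0 Y = 1.
Proof.
rewrite raw_momentE /moment_about -(pmass_sum P mX Xn).
by apply: eq_bigr => i _; rewrite expr0 mulr1.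
Qed.

Lemma central_moment0 : central_moment P 0 Y = 1.
Proof.
rewrite central_momentE /moment_about -(pmass_sum P mX Xn).
by apply: eq_bigr => i _; rewrite expr0 mulr1.
Qed.

Lemma mean_num_real_zeros : mean P Y = \sum_j q j * j%:R.
Proof. by rewrite num_real_zeros_fun (mean_finite P mX Xn). Qed.

Lemma central_moment1 : central_moment P 1 Y = 0.
Proof.
rewrite central_momentE /moment_about.
under eq_bigr do rewrite expr1 mulrBr.
by rewrite sumrB -mulr_suml (pmass_sum P mX Xn) mul1r -mean_num_real_zeros subrr.
Qed.

(** Centring at the mean cancels the first cumulant, so the sum begins with the second. *)
Lemma central_moment_rec j : central_moment P j.+2 Y =
  \sum_(i < j.+1) 'C(j.+1, i.+1)%:R * cumulant P i.+2 Y * central_moment P (j - i)%N Y.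
Proof.
rewrite central_momentE (moment_cumulant_rec _ j.+1 (@pmass_ge0 _ _ _ P X n) (pmass_sum P mX Xn) (cumulant_finite P mX Xn)).
rewrite big_ord_recl -num_real_zeros_fun.
rewrite [X in _ * (X - _)](_ : _ = mean P Y); last first.
  by rewrite num_real_zeros_fun; exact: cumulant1_finite mX Xn.
rewrite mulr1n subrr mulr0 mul0r add0r; apply: eq_bigr => i _.
by rewrite lift0 mulr0n subr0 subSS central_momentE.
Qed.

Let q0 j : 0 <= q j := @pmass_ge0 _ _ _ P X n j.

Lemma mean_num_real_zeros_ge0 : 0 <= mean P Y.
Proof. by rewrite mean_num_real_zeros sumr_ge0// => j _; rewrite mulr_ge0. Qed.

Lemma raw_moment_ge0 k : 0 <= raw_moment k Y.
Proof.
by rewrite raw_momentE sumr_ge0// => j _; rewrite mulr_ge0// subr0 exprn_ge0.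
Qed.

Lemma raw_moment_eq0 k : (1 <= k)%N -> mean P Y = 0 -> raw_moment k Y = 0.
Proof.
move=> k1; rewrite mean_num_real_zeros raw_momentE => /eqP.
rewrite psumr_eq0; last by move=> j _; rewrite mulr_ge0.
move=> /allP H; apply: big1 => j _; have := H j (mem_index_enum j).
rewrite /= mulf_eq0 => /orP[/eqP ->|]; first by rewrite mul0r.
by rewrite pnatr_eq0 => /eqP ->; rewrite subr0 expr0n; case: k k1 => // k; rewrite mulr0.
Qed.

(** Pointwise |j - m|^k <= j^5 + m for an integer j >= 0 and 0 <= m <= 1: the left side is at most
    m^k <= m if j <= m, and at most j^k <= j^5 otherwise, j being an integer. The exponent 5 covers
    both central moments needed for k = 2. *)
Lemma central_moment_le_raw k : (1 <= k <= 5)%N -> mean P Y <= 1 ->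
  `|central_moment P k Y| <= raw_moment 5 Y + mean P Y.
Proof.
move=> /andP[k1 k5] m1; have m0 := mean_num_real_zeros_ge0.
rewrite central_momentE raw_momentE; set m := mean P Y in m0 m1 *.
apply: le_trans (ler_norm_sum _ _ _) _.
have -> : moment_about q 0 5 + m = \sum_j q j * (j%:R ^+ 5 + m).
  rewrite /moment_about -[m in LHS]mul1r -(pmass_sum P mX Xn) mulr_suml -big_split /=.
  by apply: eq_bigr => j _; rewrite subr0 mulrDr.
apply: ler_sum => j _; rewrite normrM ger0_norm//; apply: ler_wpM2l => //.
rewrite normrX.
have le1 (x : R) : 0 <= x -> x <= 1 -> x ^+ k <= x.
  by move=> x0 x1; rewrite -[leRHS]expr1 ler_wiXn2l.
have j0 : 0 <= (j%:R : R) by [].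
have [jm|mj] := leP (j%:R : R) m.
  rewrite ler0_norm ?subr_le0// opprB.
  apply: (@le_trans _ _ (m ^+ k)); first by apply: lerXn2r; rewrite ?nnegrE//; lra.
  by apply: le_trans (le1 _ m0 m1) _; rewrite lerDr exprn_ge0.
rewrite gtr0_norm ?subr_gt0//.
apply: (@le_trans _ _ (j%:R ^+ k)); first by apply: lerXn2r; rewrite ?nnegrE//; lra.
apply: (@le_trans _ _ (j%:R ^+ 5)); last by rewrite lerDl.
rewrite -!natrX ler_nat; case: (nat_of_ord j) => [|i]; first by rewrite exp0n.
by rewrite leq_pexp2l.
Qed.

End Assembly.

(** * Moments when the mean is small *)

Section SmallMeans.
Context {R : realType}.

(** Through these identities the case k = 1 is the hypothesis on s_2 and s_3 itself, however small
    the mean. *)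
Lemma moments_two_three (mu s : nat -> R) : mu 0%N = 1 -> mu 1%N = 0 ->
  (forall j, mu j.+2 = \sum_(i < j.+1) 'C(j.+1, i.+1)%:R * s i.+2 * mu (j - i)%N) ->
  mu 2 = s 2 /\ mu 3 = s 3.
Proof.
move=> mu0 mu1 murec; split; first by rewrite murec big_ord1 mu0 mulr1 mul1r.
by rewrite murec big_ord_recl big_ord1 /= subn0 subnn mu0 mu1 mulr0 add0r mulr1 mul1r.
Qed.

(** Inverse of [atanE] on right endpoints; [tan] would give the default value 0 at pi/2. *)
Definition tanE (th : R) : \bar R := if th == pi / 2 then +oo%E else (tan th)%:E.

Lemma atanE_tanE (th : R) : - (pi / 2) < th <= pi / 2 -> atanE (tanE th) = th.
Proof.
move=> /andP[h1 h2]; rewrite /tanE; case: eqP => [->//|/eqP h3] /=.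
by rewrite tanK// in_itv/= h1 lt_neqAle h3.
Qed.

Lemma ltNy_tanE (th : R) : (-oo < tanE th)%E.
Proof. by rewrite /tanE; case: ifP => _; rewrite ?ltNyr. Qed.

Lemma eqO_domin (f g : nat -> R) : f =O_\oo g -> domin (fun=> True) f (fun n => `|g n|).
Proof.
move=> /eqOP[M [_ HM]]; have [N _ HN] := HM (M + 1) (ltr_pwDr ltr01 (lexx M)).
by exists (M + 1), N => n Nn _; exact: HN.
Qed.

Lemma domin_eqO (f g : nat -> R) : (forall n, 0 <= g n) -> domin (fun=> True) f g -> f =O_\oo g.
Proof.
move=> g0 [C [N H]]; apply/eqOP; exists C; split; first exact: num_real.
move=> k Ck; exists N => // n Nn; rewrite (ger0_norm (g0 n)).
by apply: le_trans (H n Nn I) _; apply: ler_wpM2r => //; exact: ltW.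
Qed.

Lemma domin_sub (D D' : nat -> Prop) (f g : nat -> R) :
  (exists N, forall n, (N <= n)%N -> D n -> D' n) -> domin D' f g -> domin D f g.
Proof.
move=> [N HN] [C [N' H]]; exists C, (maxn N N') => n.
by rewrite geq_max => /andP[n1 n2] Dn; apply: H => //; exact: HN.
Qed.

Lemma domin_cover (D D' : nat -> Prop) (f g : nat -> R) : (forall n, 0 <= g n) ->
  (forall n, D n \/ D' n) -> domin D f g -> domin D' f g -> domin (fun=> True) f g.
Proof.
move=> g0 DD [C [N H]] [C' [N' H']]; exists (Num.max C C'), (maxn N N') => n.
rewrite geq_max => /andP[n1 n2] _; have [Dn|Dn] := DD n.
  by apply: le_trans (H n n1 Dn) _; apply: ler_wpM2r => //; rewrite le_max lexx.
by apply: le_trans (H' n n2 Dn) _; apply: ler_wpM2r => //; rewrite le_max lexx orbT.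
Qed.

Context (d : measure_display) (T : measurableType d) (P : probability T R).
Variables (omega : nat -> {RV P >-> R}) (homega : iid_std_gaussian omega).
Variables (beta : nat -> R).
Hypothesis hbeta : forall j, (1 <= j)%N -> cumulant_constant omega j (beta j).

(** The arcs obtained for the individual n are assembled by choice into one sequence of intervals,
    to which the cumulant hypothesis applies. Their means being at most 1, their cumulants and hence
    their fifth moments are bounded by a constant independent of n. *)
Lemma raw_moment5_small (a b : nat -> \bar R) (ab : forall n, (a n < b n)%E) :
  domin (fun n => mean P (num_real_zeros omega n (a n) (b n)) < 1)
    (fun n => raw_moment P 5 (num_real_zeros omega n (a n) (b n)))
    (fun n => mean P (num_real_zeros omega n (a n) (b n))).
Proof.
pose Y n := num_real_zeros omega n (a n) (b n).
pose good n := (1 <= n)%N /\ 0 < mean P (Y n) < 1.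
have [th Hth] : exists th : nat -> R, forall n, good n ->
    [/\ (-oo < tanE (th n))%E,
       mean P (num_real_zeros omega n -oo%E (tanE (th n))) <= 1 &
       raw_moment P 5 (Y n) <= 8 * mean P (Y n) *
          raw_moment P 5 (num_real_zeros omega n -oo%E (tanE (th n)))].
  suff : forall n, exists th : R, good n ->
    [/\ (-oo < tanE th)%E,
       mean P (num_real_zeros omega n -oo%E (tanE th)) <= 1 &
       raw_moment P 5 (Y n) <= 8 * mean P (Y n) *
          raw_moment P 5 (num_real_zeros omega n -oo%E (tanE th))].
    by move=> /choice[th Hth]; exists th.
  move=> n; have [[n1 /andP[e0 e1]]|ng] := pselect (good n); last by exists 0 => /ng.
  have gV := giid_coeffs n homega.
  have ang : angles (atanE (a n)) (atanE (b n)).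
    by rewrite /angles atanE_ge atanE_le atanE_lt.
  rewrite /Y num_real_zeros_fun in e0 e1 *.
  have [|th [angth E1 FJ]] := mean_pow_small gV n1 ang.
    by rewrite e0 ltW.
  exists th => _.
  have thI : - (pi / 2) < th <= pi / 2 by have /and3P[_ -> ->] := angth.
  rewrite num_real_zeros_fun [atanE -oo%E]/(- (pi / 2)) (atanE_tanE thI).
  by split => //; exact: ltNy_tanE.
(* The cumulant hypothesis wants an interval for every n, so the original one fills the places where
   no arc was constructed. *)
pose a' n := if pselect (good n) then -oo%E else a n.
pose b' n := if pselect (good n) then tanE (th n) else b n.
have ab' n : (a' n < b' n)%E.
  by rewrite /a' /b'; case: pselect => gn /=; [have [] := Hth n gn|exact: ab].
pose Z n := num_real_zeros omega n (a' n) (b' n).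
have ZE n : good n -> Z n = num_real_zeros omega n -oo%E (tanE (th n)).
  by move=> gn; rewrite /Z /a' /b'; case: pselect.
have sO j : (1 <= j)%N -> domin good (fun n => cumulant P j (Z n)) (fun=> 1).
  move=> j1; have := eqO_domin (hbeta j1 ab').
  move=> /(@domin_sub good) H; have {H} [|C [N H]] := H; first by exists 0%N.
  exists (C + `|beta j|), N => n Nn gn; rewrite mulr1.
  have := H n Nn gn; rewrite normr1 mulr1 -/(Z n) => h.
  rewrite -[cumulant P j (Z n)](subrK (beta j * mean P (Z n))).
  apply: le_trans (ler_normD _ _) _; apply: lerD => //.
  have m0 : 0 <= mean P (Z n) by exact: (mean_num_real_zeros_ge0 homega n (ab' n)).
  rewrite normrM (ger0_norm m0) ler_piMr//.
  by rewrite ZE//; have [] := Hth n gn.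
have mO := @domin_raw_moments R good (fun j n => cumulant P j (Z n)) (fun k n => raw_moment P k (Z n))
  (fun n => raw_moment0 homega n (ab' n)) (fun j n _ => raw_moment_rec homega n (ab' n) j) sO 5.
have [C [N H]] := mO.
exists (8 * C), (maxn N 1) => n; rewrite geq_max => /andP[Nn n1] e1.
rewrite ger0_norm; last exact: (raw_moment_ge0 homega n (ab n) 5).
(* A zero mean admits no tiling, but then the count vanishes almost surely and so does its fifth
   moment. *)
have := mean_num_real_zeros_ge0 homega n (ab n); rewrite le_eqVlt => /orP[/eqP e0|e0].
  by rewrite -e0 mulr0 (raw_moment_eq0 homega (ab n)).
have gn : good n by split => //; rewrite e0 e1.
have [_ _ h] := Hth n gn; apply: le_trans h _.
rewrite [leRHS]mulrAC; apply: ler_wpM2l; first by rewrite mulr_ge0// ltW.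
rewrite -ZE//; have := H n Nn gn; rewrite mulr1; apply: le_trans.
exact: ler_norm.
Qed.

End SmallMeans.

Theorem corollary1p8 (R : realType) (d : measure_display)
    (T : measurableType d) (P : probability T R)
    (omega : nat -> {RV P >-> R}) (homega : iid_std_gaussian omega)
    (beta : nat -> R)
    (hbeta : forall j, (1 <= j)%N -> cumulant_constant omega j (beta j))
    (k : nat) (hk : (1 <= k)%N)
    (a b : nat -> \bar R) (hab : forall n, (a n < b n)%E)
    (hE : (3 <= k)%N -> exists2 c : R, 0 < c &
       \forall n \near \oo, c <= mean P (num_real_zeros omega n (a n) (b n))) :
  (fun n => central_moment P (2 * k) (num_real_zeros omega n (a n) (b n)) -
            (2 * k)`!%:R * beta 2%N ^+ k / (k`!%:R * 2 ^+ k) *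
            mean P (num_real_zeros omega n (a n) (b n)) ^+ k)
    =O_\oo (fun n => mean P (num_real_zeros omega n (a n) (b n)) ^+ (k - 1))
  /\
  (fun n => central_moment P (2 * k + 1) (num_real_zeros omega n (a n) (b n)) -
            (2 * k + 1)`!%:R * beta 2%N ^+ (k - 1) * beta 3%N /
            ((k - 1)`!%:R * 2 ^+ (k - 1) * 3`!%:R) *
            mean P (num_real_zeros omega n (a n) (b n)) ^+ k)
    =O_\oo (fun n => mean P (num_real_zeros omega n (a n) (b n)) ^+ (k - 1)).
Proof.
pose E n := mean P (num_real_zeros omega n (a n) (b n)).
pose s j n := cumulant P j (num_real_zeros omega n (a n) (b n)).
pose mu j n := central_moment P j (num_real_zeros omega n (a n) (b n)).
have E0 n : 0 <= E n := mean_num_real_zeros_ge0 homega n (hab n).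
have Ek0 n : 0 <= E n ^+ (k - 1) by rewrite exprn_ge0.
have evenE n : mu (2 * k)%N n - (2 * k)`!%:R * beta 2%N ^+ k / (k`!%:R * 2 ^+ k) * E n ^+ k =
    mu (2 * k)%N n - even_coef k * beta 2%N ^+ k * E n ^+ k.
  by rewrite /even_coef; congr (_ - _ * _); rewrite mulrAC.
have oddE n : mu (2 * k + 1)%N n - (2 * k + 1)`!%:R * beta 2%N ^+ (k - 1) * beta 3%N /
      ((k - 1)`!%:R * 2 ^+ (k - 1) * 3`!%:R) * E n ^+ k =
    mu (2 * k + 1)%N n - odd_coef k * beta 2%N ^+ (k - 1) * beta 3%N * E n ^+ k.
  have [m km] : exists m, k = m.+1 by exists k.-1; rewrite prednK.
  congr (_ - _ * _); rewrite km /odd_coef subSS subn0 (factS m) natrM.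
  have h1 : (m`!)%:R != 0 :> R by rewrite pnatr_eq0 -lt0n fact_gt0.
  have h2 : (2 : R) ^+ m != 0 by rewrite expf_neq0// pnatr_eq0.
  have h3 : m.+1%:R != 0 :> R by rewrite pnatr_eq0.
  have h4 : (3`!)%:R != 0 :> R by rewrite pnatr_eq0 -lt0n fact_gt0.
  by field; rewrite nat1r h1 h2 h3 h4.
have mu0 n : mu 0%N n = 1 := central_moment0 homega n (hab n).
have mu1 n : mu 1%N n = 0 := central_moment1 homega n (hab n).
have murec j n : mu j.+2 n =
  \sum_(i < j.+1) 'C(j.+1, i.+1)%:R * s i.+2 n * mu (j - i)%N n :=
  central_moment_rec homega n (hab n) j.
have sE D j : (1 <= j)%N -> domin D (fun n => s j n - beta j * E n) (fun=> 1).
  move=> j1; have := eqO_domin (hbeta j j1 a b hab).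
  under [X in domin _ _ X]funext do rewrite normr1.
  by apply: domin_sub; exists 0%N.
have asym (c : R) : 0 < c -> let D n := c <= E n in
    domin D (fun n => mu (2 * k)%N n - even_coef k * beta 2%N ^+ k * E n ^+ k) (fun n => E n ^+ (k - 1)) /\
    domin D (fun n => mu (2 * k + 1)%N n - odd_coef k * beta 2%N ^+ (k - 1) * beta 3%N * E n ^+ k)
      (fun n => E n ^+ (k - 1)).
  move=> c0 D; split.
    by apply: (@asymp_even _ D E c c0 _ s mu beta) => //; exact: sE.
  by apply: (@asymp_odd _ D E c c0 _ s mu beta) => //; exact: sE.
suff [He Ho] :
    domin (fun=> True) (fun n => mu (2 * k)%N n - even_coef k * beta 2%N ^+ k * E n ^+ k) (fun n => E n ^+ (k - 1)) /\
    domin (fun=> True) (fun n => mu (2 * k + 1)%N n - odd_coef k * beta 2%N ^+ (k - 1) * beta 3%N * E n ^+ k)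
      (fun n => E n ^+ (k - 1)).
  split; apply: domin_eqO => //; last first.
    by apply: domin_ext Ho => n _; rewrite -oddE.
  by apply: domin_ext He => n _; rewrite -evenE.
have [k3|] := leqP 3 k.
  have [c c0 [N _ HN]] := hE k3.
  have [He Ho] := asym c c0.
  by split; [apply: domin_sub He|apply: domin_sub Ho]; exists N => n Nn _; exact: HN.
rewrite ltnS leq_eqVlt => /orP[/eqP k2|k1].
  (* For k = 2 the indices are split at E = 1. Above, the general expansion applies; below, the
     central moment and the main term, a multiple of E^2, are each O(E). *)
  have [He Ho] := asym 1 ltr01.
  have [C [N HF]] := raw_moment5_small homega hbeta hab.
  have small j (e : R) : (1 <= j <= 5)%N ->
      domin (fun n => E n < 1) (fun n => mu j n - e * E n ^+ k) (fun n => E n ^+ (k - 1)).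
    move=> j5; exists (C + 1 + `|e|), N => n Nn En.
    rewrite k2 expr1; apply: le_trans (ler_normB _ _) _; rewrite mulrDl; apply: lerD.
      apply: le_trans (central_moment_le_raw homega (hab n) j5 (ltW En)) _.
      rewrite mulrDl mul1r lerD2r; apply: le_trans (HF n Nn En).
      exact: ler_norm.
    rewrite normrM ler_wpM2l// ger0_norm ?exprn_ge0// expr2 ler_piMl// ltW//.
  have cover n : 1 <= E n \/ E n < 1 by have [] := leP 1 (E n); [left|right].
  split; apply: (domin_cover _ cover) => //; apply: small; rewrite k2//.
have k1' : k = 1%N by apply/eqP; rewrite eqn_leq hk -ltnS k1.
have even1 : even_coef k = 1 :> R by rewrite k1' /even_coef (_ : (2 * 1)`! = 2)%N// (_ : 1`! = 1)%N//; field.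
have odd1 : odd_coef k = 1 :> R.
  by rewrite k1' /odd_coef (_ : (2 * 1 + 1)`! = 6)%N// (_ : 1`! = 1)%N// expr0; field.
rewrite even1 odd1 k1' subnn; under [X in domin _ _ X /\ _]funext do rewrite expr0.
under [X in _ /\ domin _ _ X]funext do rewrite expr0.
have mu23 n := @moments_two_three R (mu^~ n) (s^~ n) (mu0 n) (mu1 n) (murec^~ n).
split.
  apply: domin_ext (sE (fun=> True) 2%N isT) => n _.
  by rewrite (mu23 n).1 mul1r !expr1.
apply: domin_ext (sE (fun=> True) 3%N isT) => n _.
by rewrite (mu23 n).2 expr0 !mul1r expr1.
Qed.
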